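(* Suppose that $T:C(\mathbb{N}^* )\rightarrow C(\mathbb{N}^* )$ is a fountainless, everywhere present bounded linear operator. Then $T$ is left-locally canonizable along a quasi-open map; that is, for every infinite $B\subseteq\mathbb{N}$ there are an infinite $B_1\subseteq B$, an infinite $A\subseteq\mathbb{N}$ and a quasi-open map $\psi:B_1^*\to A^*$ such that $T_{B_1,A}$ is canonizable along $\psi$.
   Context: $\mathbb{N}^*=\beta\mathbb{N}\setminus\mathbb{N}$; for $A\subseteq\mathbb{N}$, $A^*=\overline{A}^{\beta\mathbb{N}}\setminus A$ is the corresponding clopen subset of $\mathbb{N}^*$. The dual of $C(\mathbb{N}^* )$ is identified with the space of Radon measures on $\mathbb{N}^*$, $T^\star$ is the adjoint of $T$, and $\delta_y$ is the Dirac measure at $y$. $T$ is fountainless if for every nowhere dense $F\subseteq\mathbb{N}^*$ the set $\{y\in\mathbb{N}^*: T^\star(\delta_y)\text{ is nonzero and concentrated on }F\}$ is nowhere dense; $\mu$ is concentrated on $F$ if $|\mu|(\mathbb{N}^*\setminus F)=0$ (it suffices to consider closed $F$). For infinite $A,B\subseteq\mathbb{N}$, $P_B:C(\mathbb{N}^* )\to C(B^* )$ is restriction to $B^*$, $I_A:C(A^* )\to C(\mathbb{N}^* )$ is extension by zero, and $T_{B,A}=P_B\circ T\circ I_A$. $T$ is everywhere present if $P_B\circ T\neq 0$ for every infinite $B\subseteq\mathbb{N}$. A continuous map is quasi-open if the image of every nonempty open set has nonempty interior. $T_{B,A}$ is canonizable along $\psi:B^*\to A^*$ if $\psi$ is a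 continuous surjection and there is a nonzero real $r$ with $T_{B,A}(f)=r f\circ\psi$ for all $f\in C(A^* )$. *)

(* Defs.v *)
From HB Require Import structures.
From mathcomp Require Import all_boot all_order all_algebra.
From mathcomp Require Import all_classical all_reals all_analysis.

Set Implicit Arguments.
Unset Strict Implicit.
Unset Printing Implicit Defensive.

Import Order.TTheory GRing.Theory Num.Theory.
Import numFieldNormedType.Exports.

Local Open Scope classical_set_scope.
Local Open Scope ring_scope.

HB.mixin Record Topological_isCompact T & Topological T := {
  compact_setT : compact [set: T] }.

#[short(type="compactType")]
HB.structure Definition CompactSpace :=
  { T of Topological T & Topological_isCompact T }.

Lemma compact_set_type (X : topologicalType) (A : set X) :
  compact A -> compact [set: set_type A].
Proof.
move=> cA F FF _.
have FA : (set_val @ F) A.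
  by apply: (@filterS _ F _ setT) => [x _|]; [exact: set_valP|exact: filterT].
have [p [Ap clp]] := cA (set_val @ F) _ FA.
exists (SigSub (mem_set Ap)); split => // B W FB [W' [[V oV <-] Vp VW]].
have FB' : (set_val @ F) (set_val @` B).
  by apply: (@filterS _ F _ B) => // x Bx; exists x.
have [_ [[x Bx <-] Vx]] := clp _ V FB' (open_nbhs_nbhs (conj oV Vp)).
by exists x; split => //; exact: VW.
Qed.

(* The Stone-Cech compactification of the discrete space nat, as the Stone   *)
(* space of ultrafilters on nat: the sets [set U | U A], for A : set nat,    *)
(* form a base of the topology.                                              *)
Record betaN := BetaN {
  ultra :> set nat -> Prop;
  ultraP : UltraFilter ultra }.

#[global] Existing Instance ultraP.

HB.instance Definition _ := gen_eqMixin betaN.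
HB.instance Definition _ := gen_choiceMixin betaN.

Lemma betaN_eq (U V : betaN) : ultra U = ultra V -> U = V.
Proof.
case: U V => [U hU] [V hV] /= UV; rewrite UV in hU *.
by rewrite (Prop_irrelevance hU hV).
Qed.

Section betaN_topology.

Lemma betaN_cover : \bigcup_(A in [set: set nat]) [set U : betaN | U A] = setT.
Proof. by rewrite -subTset => U _; exists setT => //=; exact: filterT. Qed.

Lemma betaN_join (A B : set nat) (U : betaN) : [set: set nat] A ->
  [set: set nat] B -> U A -> U B -> exists C,
  [/\ [set: set nat] C, U C &
    [set V : betaN | V C] `<=` [set V : betaN | V A] `&` [set V : betaN | V B]].
Proof.
move=> _ _ UA UB; exists (A `&` B); split => //; first exact: filterI.
by move=> V /= VAB; split; apply: filterS VAB => x [].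
Qed.

HB.instance Definition _ := isBaseTopological.Build betaN
  betaN_cover betaN_join.

End betaN_topology.

Lemma open_betaN (A : set nat) : open [set U : betaN | U A].
Proof. by exists [set A] => //; rewrite bigcup_set1. Qed.

Lemma betaNC (U : betaN) (A : set nat) : U (~` A) <-> ~ U A.
Proof.
split=> [UA UnA|nUA]; last by have [] := in_ultra_setVsetC A (ultraP U).
apply: (filter_not_empty (ultra U)).
by rewrite -(setICl A); exact: filterI.
Qed.

Lemma closed_betaN (A : set nat) : closed [set U : betaN | U A].
Proof.
rewrite -[X in closed X]setCK; apply: open_closedC.
rewrite (_ : ~` _ = [set U : betaN | U (~` A)]); first exact: open_betaN.
by apply/seteqP; split=> U /=; rewrite betaNC.
Qed.

Lemma nbhs_betaN (U : betaN) (W : set betaN) : nbhs U W ->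
  exists2 A, U A & [set V : betaN | V A] `<=` W.
Proof.
move=> [W' [[D' _ <-] [A D'A UA] sW]]; exists A => // V VA.
by apply: sW; exists A.
Qed.

Lemma compact_betaN : compact [set: betaN].
Proof.
rewrite compact_ultra => F FU _.
pose G : set_system nat := [set A | F [set V : betaN | V A]].
have GP : ProperFilter G.
  apply: Build_ProperFilter_ex => [A GA|].
    have [V VA] := @filter_ex _ F _ _ GA; exact: (@filter_ex _ (ultra V) _ _ VA).
  split=> [|A B GA GB|A B AB GA].
  - by apply: (@filterS _ F _ setT) => [V _ /=|]; [exact: (@filterT _ V)|exact: (@filterT _ F)].
  - apply: (@filterS _ F _ _ _ _ (@filterI _ F _ _ _ GA GB)) => V [/= VA VB].
    exact: (@filterI _ V).
  - by apply: (@filterS _ F _ _ _ _ GA) => V /=; exact: (@filterS _ V).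
have GU : UltraFilter G.
  split=> // H HP GH; apply/seteqP; split=> // A HA.
  have [//|FnA] := in_ultra_setVsetC [set V : betaN | V A] FU.
  have : H (~` A) by apply: GH; apply: filterS FnA => V /= /betaNC.
  move=> HnA; case: (filter_not_empty H).
  by rewrite -(setICr A); exact: filterI.
exists (BetaN GU); split=> // W /nbhs_betaN [A GA AW].
exact: filterS AW GA.
Qed.

Definition principal (n : nat) : betaN :=
  BetaN (principal_filter_ultra n).

Lemma principalE n (A : set nat) : principal n A <-> A n.
Proof. exact: principal_filterP. Qed.

Lemma closure_principal (A : set nat) :
  closure (principal @` A) = [set U : betaN | U A].
Proof.
apply/seteqP; split=> U.
  rewrite [X in _ -> X _](closure_id _).1; last exact: closed_betaN.
  by apply: closure_subset => _ [n An <-]; exact/principalE.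
move=> UA W /nbhs_betaN [C UC CW].
have [n [An Cn]] : A `&` C !=set0.
  by apply: (@filter_ex _ (ultra U)); exact: filterI.
by exists (principal n); split; [exists n | apply: CW; exact/principalE].
Qed.

Definition Nstar : Type := set_type (~` range principal).

HB.instance Definition _ := SubChoice.on Nstar.
HB.instance Definition _ := Topological.on Nstar.

Lemma closed_Nstar : closed (~` range principal).
Proof.
apply: open_closedC.
rewrite (_ : range principal = \bigcup_n [set U : betaN | U [set n]]).
  by apply: bigcup_open => n _; exact: open_betaN.
apply/seteqP; split=> [_ [n _ <-]|U [n _ Un]].
  by exists n => //; exact/principalE.
exists n => //; apply: betaN_eq; apply/esym.
apply: (@max_filter _ _ (ultraP (principal n))).
by move=> A /principalE An; apply: (@filterS _ U _ _ _ _ Un) => _ ->.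
Qed.

Lemma compact_Nstar : compact [set: Nstar].
Proof.
apply: compact_set_type.
exact: (subclosed_compact closed_Nstar compact_betaN).
Qed.

HB.instance Definition _ := Topological_isCompact.Build Nstar compact_Nstar.

Lemma Nstar_nonempty : exists x : Nstar, True.
Proof.
have [G [GU GF]] := @ultraFilterLemma nat \oo _.
suff h : (~` range principal) (BetaN GU) by exists (SigSub (mem_set h)).
move=> [n _ /(congr1 ultra)/= Gn].
have : G [set m | (n < m)%N] by apply: GF; exists n.+1.
by rewrite -Gn => /principal_filterP/=; rewrite ltnn.
Qed.

HB.instance Definition _ := isPointed.Build Nstar (projT1 (cid Nstar_nonempty)).

(* A^*, as a subset of Nstar. *)
Definition star (A : set nat) : set Nstar :=
  set_val @^-1` (closure (principal @` A) `\` (principal @` A)).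

Lemma starE (A : set nat) (x : Nstar) : star A x <-> (set_val x : betaN) A.
Proof.
rewrite /star/= closure_principal; split=> [[]//|xA]; split => //.
by move=> [n An nx]; apply: (set_valP x); exists n.
Qed.

Lemma clopen_star (A : set nat) : clopen (star A).
Proof.
rewrite (_ : star A = set_val @^-1` [set U : betaN | U A]).
  apply: preimage_clopen; first by split; [exact: open_betaN|exact: closed_betaN].
  exact: initial_continuous.
by apply/seteqP; split=> x /starE.
Qed.

Definition Astar (A : set nat) : Type := set_type (star A).

HB.instance Definition _ A := SubChoice.on (Astar A).
HB.instance Definition _ A := Topological.on (Astar A).

Lemma compact_Astar A : compact [set: Astar A].
Proof.
apply: compact_set_type.
exact: (subclosed_compact (clopen_star A).2 compact_Nstar).
Qed.

HB.instance Definition _ A := Topological_isCompact.Build (Astar A)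
  (@compact_Astar A).

(* C(K), with the supremum norm. *)
Definition Cspace (R : realType) (K : compactType) : Type := continuousType K R.

Section Cspace_lmodule.
Variables (R : realType) (K : compactType).
Implicit Types f g h : Cspace R K.

Definition mkC (f : K -> R) (cf : continuous f) : Cspace R K :=
  (mkcts cf : continuousType K R).

Lemma mkCE (f : K -> R) (cf : continuous f) x : mkC cf x = f x.
Proof. by []. Qed.

Lemma CspaceP f g : (forall x, f x = g x) -> f = g.
Proof. by move=> fg; apply/continuousEP. Qed.

Lemma Cspace_continuous f : continuous (f : K -> R).
Proof. exact: (@cts_fun K R f). Qed.

HB.instance Definition _ := Choice.copy (Cspace R K) (continuousType K R).

Definition Cspace_add f g : Cspace R K :=
  mkC (fun x => continuousD (@Cspace_continuous f x) (@Cspace_continuous g x)).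
Definition Cspace_opp f : Cspace R K :=
  mkC (fun x => continuousN (@Cspace_continuous f x)).
Definition Cspace_zero : Cspace R K := mkC (@cst_continuous K R 0).
Definition Cspace_scale (a : R) f : Cspace R K :=
  mkC (fun x => continuousM (@cst_continuous K R a x)
                            (@Cspace_continuous f x)).

Lemma Cspace_addA : associative Cspace_add.
Proof. by move=> f g h; apply: CspaceP => x; exact: addrA. Qed.
Lemma Cspace_addC : commutative Cspace_add.
Proof. by move=> f g; apply: CspaceP => x; exact: addrC. Qed.
Lemma Cspace_add0 : left_id Cspace_zero Cspace_add.
Proof. by move=> f; apply: CspaceP => x; exact: add0r. Qed.
Lemma Cspace_addN : left_inverse Cspace_zero Cspace_opp Cspace_add.
Proof. by move=> f; apply: CspaceP => x; exact: addNr. Qed.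

HB.instance Definition _ :=
  GRing.isZmodule.Build (Cspace R K)
    Cspace_addA Cspace_addC Cspace_add0 Cspace_addN.

Lemma Cspace_scaleA a b f :
  Cspace_scale a (Cspace_scale b f) = Cspace_scale (a * b) f.
Proof. by apply: CspaceP => x; exact: mulrA. Qed.
Lemma Cspace_scale1 : left_id 1 Cspace_scale.
Proof. by move=> f; apply: CspaceP => x; exact: mul1r. Qed.
Lemma Cspace_scaleDr : right_distributive Cspace_scale +%R.
Proof. by move=> a f g; apply: CspaceP => x; exact: mulrDr. Qed.
Lemma Cspace_scaleDl f : {morph Cspace_scale^~ f : a b / a + b}.
Proof. by move=> a b; apply: CspaceP => x; exact: mulrDl. Qed.

HB.instance Definition _ := GRing.Zmodule_isLmodule.Build R (Cspace R K)
  Cspace_scaleA Cspace_scale1 Cspace_scaleDr Cspace_scaleDl.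

Lemma CspaceD f g x : (f + g) x = f x + g x. Proof. by []. Qed.
Lemma CspaceN f x : (- f) x = - f x. Proof. by []. Qed.
Lemma Cspace0 x : (0 : Cspace R K) x = 0. Proof. by []. Qed.
Lemma CspaceZ a f x : (a *: f) x = a * f x. Proof. by []. Qed.

Definition supnorm f : R := sup (range (fun x => `|f x|)).

Lemma supnorm_bounded f : has_ubound (range (fun x => `|f x|)).
Proof.
have : compact (range f).
  apply: continuous_compact; last exact: compact_setT.
  by apply: continuous_subspaceT => x; exact: Cspace_continuous.
move=> /compact_bounded[M [_ Mf]]; exists (M + 1) => _ [x _ <-].
by apply: (Mf (M + 1)); [rewrite ltrDl|exists x].
Qed.

Lemma le_supnorm f x : `|f x| <= supnorm f.
Proof. by apply: ub_le_sup; [exact: supnorm_bounded|exists x]. Qed.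

Lemma supnorm_le f M : 0 <= M -> (forall x, `|f x| <= M) -> supnorm f <= M.
Proof.
move=> M0 fM; rewrite /supnorm; have [->|/set0P f0] :=
    eqVneq (range (fun x => `|f x|)) set0.
  by rewrite sup0.
by apply: ge_sup => // _ [x _ <-].
Qed.

Lemma supnorm_ge0 f : 0 <= supnorm f.
Proof.
rewrite /supnorm; have [->|/set0P[y [x _ _]]] :=
    eqVneq (range (fun x => `|f x|)) set0.
  by rewrite sup0.
exact: le_trans (le_supnorm f x).
Qed.

Lemma supnormD f g : supnorm (f + g) <= supnorm f + supnorm g.
Proof.
apply: supnorm_le => [|x]; first by rewrite addr_ge0// supnorm_ge0.
by rewrite CspaceD (le_trans (ler_normD _ _))// lerD// le_supnorm.
Qed.

Lemma supnormZ_le a f : supnorm (a *: f) <= `|a| * supnorm f.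
Proof.
apply: supnorm_le => [|x]; first by rewrite mulr_ge0// supnorm_ge0.
by rewrite CspaceZ normrM ler_wpM2l// le_supnorm.
Qed.

Lemma supnormZ a f : supnorm (a *: f) = `|a| * supnorm f.
Proof.
apply/eqP; rewrite eq_le supnormZ_le/=.
have [->|a0] := eqVneq a 0; first by rewrite normr0 mul0r supnorm_ge0.
rewrite -ler_pdivlMl ?normr_gt0// -normfV.
by rewrite -[X in supnorm X <= _](scalerK a0) supnormZ_le.
Qed.

Lemma supnorm_eq0 f : supnorm f = 0 -> f = 0.
Proof.
move=> f0; apply: CspaceP => x; apply/eqP; rewrite Cspace0 -normr_le0 -f0.
exact: le_supnorm.
Qed.

HB.instance Definition _ := Lmodule_isNormed.Build R (Cspace R K)
  supnormD supnormZ supnorm_eq0.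

Lemma Cspace_normE f : `|f| = sup (range (fun x => `|f x|)).
Proof. by []. Qed.

End Cspace_lmodule.

Notation Borel K := (g_sigma_algebraType (@open K)).

Section Radon.
Variable R : realType.
Implicit Types nu mu : {charge set (Borel Nstar) -> \bar R}.

Definition hahn_pos nu := projT1 (cid (Hahn_decomposition nu)).
Definition hahn_neg nu := projT1 (cid (projT2 (cid (Hahn_decomposition nu)))).
Definition hahnP nu : hahn_decomposition nu (hahn_pos nu) (hahn_neg nu) :=
  projT2 (cid (projT2 (cid (Hahn_decomposition nu)))).

Definition variation nu : {measure set (Borel Nstar) -> \bar R} :=
  charge_variation (hahnP nu).

Definition charge_integral nu (f : Cspace R Nstar) : R :=
  (\int[jordan_pos (hahnP nu)]_x f x - \int[jordan_neg (hahnP nu)]_x f x)%R.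

(* A charge is a finite signed measure; as Nstar is compact Hausdorff, outer  *)
(* regularity of the variation follows from inner regularity.                 *)
Definition Radon nu := forall E : set (Borel Nstar), measurable E ->
  variation nu E =
    ereal_sup [set variation nu K | K in [set K | @compact Nstar K /\ K `<=` E]].

Definition delta (y : Nstar) : {charge set (Borel Nstar) -> \bar R} :=
  charge_of_finite_measure (@dirac _ (Borel Nstar) y R).

(* nu = T^* mu, under the identification of the dual of C(Nstar) with the     *)
(* space of Radon measures. Such a nu exists and is unique on Borel sets, by  *)
(* the Riesz representation theorem.                                          *)
Definition is_adjoint_image (T : Cspace R Nstar -> Cspace R Nstar) mu nu :=
  Radon nu /\ forall f, charge_integral nu f = charge_integral mu (T f).

(* The values of nu on non-measurable sets carry no information.              *)
Definition charge_nonzero nu := exists2 E, measurable E & nu E != 0%E.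

(* F need not be Borel: the complement of F is required to be contained in a  *)
(* Borel set of |nu|-measure 0.                                               *)
Definition concentrated nu (F : set Nstar) :=
  (variation nu).-negligible (~` F).

End Radon.

Section operators.
Variable R : realType.
Implicit Types (A B : set nat) (T : {linear Cspace R Nstar -> Cspace R Nstar}).

Lemma sigL_continuous B (f : Cspace R Nstar) : continuous (sigL (star B) f).
Proof.
move=> x; apply: continuous_comp; first exact: initial_continuous.
exact: Cspace_continuous.
Qed.

Lemma valL_out A (f : Astar A -> R) x : ~ star A x -> valL_ (0 : R) f x = 0.
Proof.
move=> nAx; have := congr1 (fun h => h (valL_ (0 : R) f) x) (@sigLK _ _ (0 : R) (star A)).
by rewrite /= (valLK (0 : R) f) /patch memNset.
Qed.

Lemma valL_in A (f : Astar A -> R) (x : Astar A) :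
  valL_ (0 : R) f (set_val (x : set_type (star A))) = f x.
Proof. exact: (congr1 (fun h => h x) (valLK (0 : R) f)). Qed.

Lemma valL_continuous A (f : Cspace R (Astar A)) : continuous (valL_ (0 : R) f).
Proof.
have [oA cA] := clopen_star A.
move=> x; have [xA|xA] := pselect (star A x).
  have := (@subspace_valL_continuousP' _ (star A) _ (0 : R) f).2
    (@Cspace_continuous _ _ f).
  by rewrite continuous_open_subspace//; apply; exact: mem_set.
apply: (near_cst_continuous (0 : R)).
have : nbhs x (~` star A) by apply: open_nbhs_nbhs; split => //; exact: closed_openC.
by apply: filterS => y; exact: valL_out.
Qed.

Definition Pres B (f : Cspace R Nstar) : Cspace R (Astar B) :=
  @mkC R (Astar B) (sigL (star B) f) (@sigL_continuous B f).

Definition Iext A (f : Cspace R (Astar A)) : Cspace R Nstar :=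
  @mkC R Nstar (valL_ 0 f) (@valL_continuous A f).

Definition localize T (B A : set nat) :
    Cspace R (Astar A) -> Cspace R (Astar B) :=
  @Pres B \o T \o @Iext A.

End operators.

Arguments Pres {R} B f.
Arguments Iext {R} A f.
Arguments localize {R} T B A f.

Section operator_properties.
Variable R : realType.
Implicit Types (A B : set nat) (T : {linear Cspace R Nstar -> Cspace R Nstar}).

Definition nowhere_dense (X : topologicalType) (F : set X) :=
  (closure F)° = set0.

Definition fountainless T := forall F : set Nstar, nowhere_dense F ->
  nowhere_dense [set y : Nstar | exists nu,
    [/\ is_adjoint_image T (delta R y) nu,
        charge_nonzero nu & concentrated nu F]].

Definition everywhere_present T := forall B, infinite_set B ->
  Pres B \o T <> \0.

Definition bounded_operator T :=
  exists M : R, forall f, `|T f| <= M * `|f|.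

Definition quasi_open (X Y : topologicalType) (psi : X -> Y) :=
  continuous psi /\
  forall U, open U -> U !=set0 -> (psi @` U)° !=set0.

Definition canonizable T B A (psi : Astar B -> Astar A) :=
  [/\ continuous psi, set_surj setT setT psi &
    exists2 r : R, r != 0 &
      forall f x, localize T B A f x = r * f (psi x)].

Definition left_locally_canonizable_quasi_open T :=
  forall B, infinite_set B ->
  exists B1 A (psi : Astar B1 -> Astar A),
    [/\ B1 `<=` B, infinite_set B1, infinite_set A, quasi_open psi &
      canonizable T psi].

End operator_properties.

(* Main.v *)
Require Import Defs.
From HB Require Import structures.
From mathcomp Require Import all_boot all_order all_algebra.
From mathcomp Require Import all_classical all_reals all_analysis.
From mathcomp Require Import measurable_realfun ring lra.

(** For a point [y] of the remainder let [mu_y] be the adjoint image of the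
    Dirac measure at [y], and write [t_y A] for the variation of [mu_y] on the
    clopen set [star A]. The variation is computed directly from the functional
    [L_y f = T f y], as the supremum of [L_y f] over the [f] of supremum norm
    at most one that vanish off [star A]; it is finitely additive in [A] and
    lower semicontinuous in [y] ([tv_lsc]). The aim is a clopen set [star B] of
    points [y] and a clopen set [star A] such that, for all these [y], the
    measure [mu_y] restricted to [star A] is a nonzero point mass. Its location
    [psi y] then depends continuously on [y], and [T f y = r * f (psi y)] for
    [f] supported on [star A], where [r] is the value of [T 1_A], which can be
    made constant by shrinking [star B].

    Every step that shrinks sets rests on one fact: a decreasing sequence of
    nonempty clopen subsets of the remainder has a nonempty clopen lower bound
    ([star_sigma_closed]). Hence countably many dense requirements can be met
    at once ([generic_star]), a monotone real quantity can be stabilized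
    ([sigma_closed_stable]), and a bounded lower semicontinuous function is
    constant on a nonempty clopen set ([lsc_star_constant]).

    Point masses come from an energy. Once the total variation is constant,
    each [t_y A] is continuous in [y]; for a finite clopen cover [s] the energy
    of [y] is the sum of the squares [t_y P ^ 2] over [P] in [s]. Its infimum
    over [s] is made constant, and covers [s_n] are chosen whose energy is
    within [1/n] of that infimum uniformly in [y]. Splitting a piece of [s_n]
    into parts of masses [a] and [b] lowers its energy by [2ab]; so if [star A]
    is contained in a piece of every [s_n], no splitting of [A] can have two
    parts of positive mass: [t_y] is two-valued on [A]
    ([subordinate_two_valued]). The union of these [star A] is open and dense.

    It remains to find such an [A] with [t_y A > 0]. Shrink simultaneously the
    clopen set of points [y] and a dense open set [G] of the remainder until
    the supremum of [t_y C] over [star C] in [G] no longer drops. If it were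
    zero, every [mu_y] would be concentrated on the nowhere dense complement of
    [G], which fountainlessness forbids ([fountainless_tv]); so some two-valued
    [A] with [star A] in [G] is charged. If [psi] mapped a clopen set [star D]
    onto a set with empty interior, then removing this closed nowhere dense
    image from [G] would remove the mass of [A] for all [y] in [star D] and
    lower the stable supremum ([exists_quasi_open_atom]). So [psi] is
    quasi-open, and cutting down to a clopen set inside its image makes it
    onto.

    Applying fountainlessness needs the measures themselves, not only their
    values on clopen sets. The two contents [t_y] and [t_y - L_y 1_A] are
    nonnegative; each is extended to a Radon measure on all Borel sets by inner
    approximation of open sets followed by outer approximation, and the
    difference of the two is the charge representing [L_y]
    ([riesz_charge_integral]). *)

Set Implicit Arguments.
Unset Strict Implicit.
Unset Printing Implicit Defensive.

Import Order.TTheory GRing.Theory Num.Theory.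
Import numFieldNormedType.Exports.

Local Open Scope classical_set_scope.
Local Open Scope ring_scope.

(** * Clopen subsets of the remainder *)

Section star_algebra.
Implicit Types (A B : set nat) (x : Nstar).

Lemma starT : star [set: nat] = [set: Nstar].
Proof. by apply/seteqP; split=> // x _; apply/starE; exact: filterT. Qed.

Lemma star0 : star set0 = set0.
Proof.
by apply/seteqP; split=> // x /starE; exact: (filter_not_empty (ultra _)).
Qed.

Lemma starI A B : star (A `&` B) = star A `&` star B.
Proof.
apply/seteqP; split=> [x /starE xAB|x [/starE xA /starE xB]].
  by split; apply/starE; apply: filterS xAB => n [].
by apply/starE; exact: filterI.
Qed.

Lemma starC A : star (~` A) = ~` star A.
Proof. by apply/seteqP; split=> x; rewrite /= !starE betaNC. Qed.

Lemma starU A B : star (A `|` B) = star A `|` star B.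
Proof. by rewrite -[A `|` B]setCK setCU starC starI !starC setCI !setCK. Qed.

Lemma starD A B : star (A `\` B) = star A `\` star B.
Proof. by rewrite setDE starI starC. Qed.

Lemma star_sub A B : A `<=` B -> star A `<=` star B.
Proof. by move=> AB x /starE xA; apply/starE; apply: filterS AB xA. Qed.

Lemma open_star A : open (star A). Proof. exact: (clopen_star A).1. Qed.
Lemma closed_star A : closed (star A). Proof. exact: (clopen_star A).2. Qed.

Lemma nbhs_Nstar x (W : set Nstar) : nbhs x W ->
  exists2 A, star A x & star A `<=` W.
Proof.
move=> [W' [[V oV <-] Vx VW]].
have [A xA AV] := nbhs_betaN (open_nbhs_nbhs (conj oV Vx)).
by exists A; [exact/starE | move=> y /starE yA; apply/VW/AV].
Qed.

Lemma star_nbhs x A : star A x -> nbhs x (star A).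
Proof. by move=> xA; apply: open_nbhs_nbhs; split=> //; exact: open_star. Qed.

(** A finite set has only principal ultrafilters, while the complements of
    finite subsets of an infinite set generate a proper filter, and any
    ultrafilter refining it is nonprincipal. *)
Lemma star_neq0 A : star A !=set0 <-> infinite_set A.
Proof.
split=> [[x /starE xA] /finite_setP[n]|Ainf].
  move=> /card_esym /pcard_eqP /bijPex [f [_ _ fsurj]].
  have : forall m, (ultra (set_val x)) (f @` `I_m) ->
      exists k, ultra (set_val x) [set k].
    elim=> [|m IH]; first by rewrite II0 image_set0 => /(filter_not_empty _).
    rewrite IIS image_setU image_set1.
    have [h _|/betaNC h xU] := pselect (ultra (set_val x) [set f m]).
      by exists (f m).
    apply: IH; apply: filterS (filterI xU h) => k [[//|->]].
    by case.
  move=> /(_ n) [|k xk]; first exact: filterS xA.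
  apply: (set_valP x); exists k => //; apply: betaN_eq; apply/esym.
  apply: (@max_filter _ _ (ultraP (principal k))) => C /principalE Ck.
  by apply: filterS xk => _ ->.
pose F : set_system nat := filter_from finite_set (fun C => A `\` C).
have FP : ProperFilter F.
  apply: filter_from_proper; first apply: filter_from_filter.
  - by exists set0; exact: finite_set0.
  - move=> C D fC fD; exists (C `|` D); first by rewrite finite_setU.
    by move=> n [An /not_orP[]].
  - move=> C fC; apply/set0P/eqP => h; apply: Ainf.
    by apply: sub_finite_set fC => n An; apply: contrapT => nC;
       move: (h); rewrite -subset0 => /(_ n); apply.
have [G [GU FG]] := ultraFilterLemma FP.
suff h : (~` range principal) (BetaN GU).
  exists (SigSub (mem_set h)); apply/starE; apply: FG.
  by exists set0; [exact: finite_set0|rewrite setD0].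
move=> [n _ /(congr1 ultra)/= Gn].
have : G (~` [set n]).
  by apply: FG; exists [set n]; [exact: finite_set1| move=> k []].
by rewrite -Gn => /principalE; apply.
Qed.

Lemma open_star_sub (W : set Nstar) : open W -> W !=set0 ->
  exists2 A, star A !=set0 & star A `<=` W.
Proof.
move=> oW [x Wx]; have [A xA AW] := nbhs_Nstar (open_nbhs_nbhs (conj oW Wx)).
by exists A => //; exists x.
Qed.

Lemma star_subE A B : star A `<=` star B <-> finite_set (A `\` B).
Proof.
rewrite -setD_eq0 -starD; split=> [/eqP h|fAB].
  by apply: contrapT => /star_neq0/set0P; rewrite h.
by apply: contrapT => /eqP/set0P/star_neq0.
Qed.

(** Zero-dimensional normality. If no clopen set inside [U] covered [K], the
    sets [K] minus [star C] would generate a proper filter, whose cluster point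
    lies in [K], hence in some [star C] inside [U]. *)
Lemma star_separation (K U : set Nstar) : closed K -> open U -> K `<=` U ->
  exists C, K `<=` star C /\ star C `<=` U.
Proof.
move=> cK oU KU; apply: contrapT => nC.
have nC' C : star C `<=` U -> exists2 x, K x & ~ star C x.
  move=> CU; apply: contrapT => h; apply: nC; exists C; split=> // x Kx.
  by apply: contrapT => nx; apply: h; exists x.
pose F := filter_from [set C | star C `<=` U] (fun C => K `\` star C).
have FP : ProperFilter F.
  apply: filter_from_proper; first apply: filter_from_filter.
  - by exists set0; rewrite /= star0.
  - move=> C D CU DU; exists (C `|` D); first by rewrite /= starU subUset.
    by rewrite starU => x [Kx /not_orP[]].
  - by move=> C /nC' [x Kx nx]; exists x.
have cptK : compact K.
  by apply: (subclosed_compact cK (@compact_setT Nstar)).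
have FK : F K by exists set0 => /=; [rewrite star0|move=> x []].
have [x [Kx clx]] := cptK F FP FK.
have [C xC CU] := nbhs_Nstar (open_nbhs_nbhs (conj oU (KU _ Kx))).
have [y [[_ +] ?]] : (K `\` star C) `&` star C !=set0.
  by apply: clx; [exists C|exact: star_nbhs].
exact.
Qed.

End star_algebra.

(** * Generic elements of sigma-closed orders *)

Section sigma_closed.
Variables (X : Type) (le : X -> X -> Prop) (V : set X).
Hypothesis le_xx : forall x, le x x.
Hypothesis le_tr : forall y x z, le x y -> le y z -> le x z.
Hypothesis sigma_closed : forall u : nat -> X, (forall n, V (u n)) ->
  (forall n, le (u n.+1) (u n)) -> exists2 x, V x & forall n, le x (u n).

(** The Baire category argument: meet the requirements one after the other
    along a decreasing sequence, then take a lower bound of it. *)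
Lemma sigma_closed_generic (D : nat -> set X) :
  (forall n x, V x -> exists x', [/\ V x', le x' x & D n x']) ->
  (forall n x' x, le x' x -> D n x -> D n x') ->
  forall x0, V x0 -> exists x, [/\ V x, le x x0 & forall n, D n x].
Proof.
move=> Dd Dh x0 Vx0.
have [f fP] : exists f : nat -> X -> X, forall n x, V x ->
    [/\ V (f n x), le (f n x) x & D n (f n x)].
  have /choice[f fP] : forall nx : nat * X, exists x', V nx.2 ->
      [/\ V x', le x' nx.2 & D nx.1 x'].
    move=> [n x]; have [/(Dd n)[x' h]|nV] := pselect (V x); first by exists x'.
    by exists x.
  by exists (fun n x => f (n, x)) => n x /(fP (n, x)).
pose u := fix u n := if n is m.+1 then f m (u m) else x0.
have Vu n : V (u n) by elim: n => //= n IH; have [] := fP n _ IH.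
have [x Vx lex] := sigma_closed Vu (fun n => let: And3 _ h _ := fP n _ (Vu n) in h).
exists x; split=> // [|n]; first exact: (lex 0).
apply: (Dh n _ (u n.+1)); first exact: lex.
by have [] := fP n _ (Vu n).
Qed.

(** Take a generic element for the dense requirements that [phi] be within
    [1/n] of the infimum of its values below. *)
Lemma sigma_closed_stable (R : realType) (phi : X -> R) (m : R) :
  (forall x, V x -> m <= phi x) ->
  (forall x y, V x -> V y -> le x y -> phi x <= phi y) ->
  forall x0, V x0 -> exists x, [/\ V x, le x x0 &
    forall y, V y -> le y x -> phi y = phi x].
Proof.
move=> phim phile x0 Vx0.
pose I x := inf [set phi y | y in [set y | V y /\ le y x]].
have hI x : V x -> has_inf [set phi y | y in [set y | V y /\ le y x]].
  by move=> Vx; split; [exists (phi x), x | exists m => _ [y [Vy _] <-]; exact: phim].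
have IP x y : V x -> V y -> le y x -> I x <= phi y.
  by move=> Vx Vy yx; apply: ge_inf; [exact: (hI _ Vx).2|exists y].
have Ile x y : V x -> V y -> le y x -> I x <= I y.
  move=> Vx Vy yx; apply: lb_le_inf; first exact: (hI _ Vy).1.
  by move=> _ [z [Vz zy] <-]; apply: IP => //; exact: le_tr zy yx.
pose D n := [set x | forall y, V y -> le y x -> phi y < I y + n.+1%:R^-1].
suff [x [Vx xx0 Dx]] : exists x, [/\ V x, le x x0 & forall n, D n x].
  exists x; split=> // y Vy yx; apply/eqP; rewrite eq_le phile//=.
  apply/ler_addgt0Pr => e e0.
  have [n _ /(_ n (leqnn n)) ne] := near_infty_natSinv_lt (PosNum e0).
  (* At [x] itself the requirement bounds [phi x] by its infimum below plus
     [1/n]. *)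
  have := Dx n x Vx (le_xx x) => /ltW/le_trans; apply.
  by apply: lerD; [exact: IP|exact: ltW].
apply: sigma_closed_generic => //.
- move=> n x Vx; have e0 : 0 < n.+1%:R^-1 :> R by rewrite invr_gt0.
  have [_ [y [Vy yx] <-] ylt] := inf_adherent e0 (hI _ Vx).
  exists y; split=> // z Vz zy; apply: le_lt_trans (phile _ _ Vz Vy zy) _.
  by apply: (lt_le_trans ylt); rewrite lerD2r; apply: Ile => //; exact: le_tr zy yx.
- by move=> n y x yx Dx z Vz zy; apply: Dx => //; exact: le_tr zy yx.
Qed.

End sigma_closed.

(** A pseudo-intersection: choose an increasing sequence whose [n]th term
    belongs to the first [n] sets; it is almost contained in each of them. *)
Lemma star_sigma_closed (A : nat -> set nat) :
  (forall n, star (A n) !=set0) -> (forall n, star (A n.+1) `<=` star (A n)) ->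
  exists2 B, star B !=set0 & forall n, star B `<=` star (A n).
Proof.
move=> A0 Adec.
pose C := fix C n := if n is m.+1 then C m `&` A m.+1 else A 0.
have CE n : star (C n) = star (A n).
  elim: n => //= n IH; rewrite starI IH setIidr//; exact: Adec.
have CA n : C n `<=` A n by case: n => //= n k [].
have Cdec m n : (m <= n)%N -> C n `<=` C m.
  move=> /subnK <-; elim: (n - m)%N => // k IH j; rewrite addSn /= => -[+ _].
  exact: IH.
have /choice[f fP] : forall nm : nat * nat, exists k, C nm.1 k /\ (nm.2 < k)%N.
  move=> [n m]; have : infinite_set (C n) by apply/star_neq0; rewrite CE.
  move=> Cinf; apply: contrapT => h; apply: Cinf.
  apply: (@sub_finite_set _ _ `I_m.+1); last exact: finite_II.
  by move=> k Ck; rewrite /= ltnNge; apply/negP => mk; apply: h; exists k.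
pose u := fix u n := f (n, if n is m.+1 then u m else 0%N).
have uC n : C n (u n) by case: n => [|n]; [have [] := fP (0%N, 0%N)|have [] := fP (n.+1, u n)].
have uS n : (u n < u n.+1)%N by have [] := fP (n.+1, u n).
have uinc : {homo u : m n / (m < n)%N} by exact: (homo_ltn (@ltn_trans)).
exists (range u) => [|n].
  apply/star_neq0 => fu; apply: infinite_nat.
  apply: (@sub_finite_set _ _ (u @^-1` range u)); first by move=> n _; exists n.
  apply: finite_preimage => // m n _ _; case: (ltngtP m n) => // /uinc.
    by move=> /[swap] ->; rewrite ltnn.
  by move=> /[swap] ->; rewrite ltnn.
apply/star_subE; apply: (@sub_finite_set _ _ (u @` `I_n)).
  move=> _ [[m _ <-] nA]; exists m => //=; rewrite ltnNge; apply/negP => nm.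
  by apply: nA; apply: CA; apply: Cdec nm _ (uC m).
by apply: finite_image; exact: finite_II.
Qed.

Definition clopen_below A0 : set (set nat) :=
  [set A | star A !=set0 /\ star A `<=` star A0].

Lemma clopen_below_sigma_closed A0 (A : nat -> set nat) :
  (forall n, clopen_below A0 (A n)) -> (forall n, star (A n.+1) `<=` star (A n)) ->
  exists2 B, clopen_below A0 B & forall n, star B `<=` star (A n).
Proof.
move=> VA Adec; have [B nB BA] := star_sigma_closed (fun n => (VA n).1) Adec.
by exists B => //; split=> //; apply: subset_trans (BA 0%N) (VA 0%N).2.
Qed.

Lemma generic_star (D : nat -> set (set Nstar)) A0 :
  (forall n A, star A !=set0 -> star A `<=` star A0 ->
    exists A', [/\ star A' !=set0, star A' `<=` star A & D n (star A')]) ->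
  (forall n A B, star A `<=` star B -> D n (star B) -> D n (star A)) ->
  star A0 !=set0 ->
    exists A, [/\ star A !=set0, star A `<=` star A0 & forall n, D n (star A)].
Proof.
move=> Dd Dh nA0.
suff [A [[nA AA0] _ DA]] : exists A, [/\ clopen_below A0 A, star A `<=` star A0 &
    forall n, D n (star A)] by exists A.
apply: (@sigma_closed_generic _ (fun A B => star A `<=` star B)
  (clopen_below A0) _ (fun n => [set A | D n (star A)])) => //.
- exact: clopen_below_sigma_closed.
- move=> n A [nA AA0]; have [B [nB BA DB]] := Dd n A nA AA0.
  by exists B; split=> //; split=> //; exact: subset_trans AA0.
- by split.
Qed.

Section semicontinuous.
Variable R : realType.
Implicit Types g : Nstar -> R.

(** Only the points of [W] are constrained, but the neighbourhoods are those of
    the whole space; for open [W] this is lower semicontinuity of the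
    restriction. *)
Definition lsc_on (W : set Nstar) g :=
  forall c y, W y -> c < g y -> \forall z \near y, c < g z.

(** Stabilize the infimum of [g] over the clopen sets. If [g] took a larger
    value at a point, semicontinuity would give a smaller clopen set with a
    larger infimum. *)
Lemma lsc_star_constant g B (M : R) : lsc_on (star B) g ->
  (forall y, star B y -> `|g y| <= M) -> star B !=set0 ->
  exists A c, [/\ star A !=set0, star A `<=` star B &
    forall y, star A y -> g y = c].
Proof.
move=> lg gM nB.
pose V := clopen_below B.
pose phi A := sup [set - g y | y in star A].
have hs A : V A -> has_sup [set - g y | y in star A].
  move=> [[x Ax] AB]; split; first by exists (- g x), x.
  by exists M => _ [y /AB/gM + <-]; rewrite ler_norml lerNl => /andP[].
have phiP A y : V A -> star A y -> - g y <= phi A.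
  by move=> VA Ay; apply: ub_le_sup; [exact: (hs _ VA).2|exists y].
have phile A c : V A -> (forall y, star A y -> - g y <= c) -> phi A <= c.
  move=> VA h; apply: ge_sup; first exact: (hs _ VA).1.
  by move=> _ [y Ay <-]; exact: h.
suff [A [[nA AB] _ Aphi]] : exists A, [/\ V A, star A `<=` star B &
    forall C, V C -> star C `<=` star A -> phi C = phi A].
  exists A, (- phi A); split=> // y Ay; apply/eqP; rewrite eq_le.
  rewrite [_ <= g y]lerNl phiP// andbT leNgt; apply/negP => yA.
  (* A value strictly between the infimum and [g y]. *)
  pose c := (- phi A + g y) / 2.
  have yc : c < g y by rewrite /c; lra.
  have [C yC Cc] := nbhs_Nstar (lg _ _ (AB _ Ay) yc).
  have CAy : star (A `&` C) y by rewrite starI.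
  have CAA : star (A `&` C) `<=` star A by apply: star_sub => n [].
  have VCA : V (A `&` C) by split; [exists y|exact: subset_trans CAA AB].
  have : phi (A `&` C) <= - c.
    by apply: phile => // z; rewrite starI lerN2 => -[_ /Cc/ltW].
  by rewrite (Aphi _ VCA)// /c; lra.
apply: (@sigma_closed_stable _ (fun A B => star A `<=` star B) V _ _ _ R phi (- M)).
- by move=> C x.
- by move=> C D E DC CE x /DC /CE.
- exact: clopen_below_sigma_closed.
- move=> A VA; have [x Ax] := VA.1; apply: le_trans (phiP _ _ VA Ax).
  by have := gM _ (VA.2 _ Ax); rewrite ler_norml lerN2 => /andP[].
- by move=> A C VA VC AC; apply: phile => // y /AC; exact: phiP.
- by split.
Qed.

End semicontinuous.

(** Below any clopen set a generic one is contained in every [G n] and, being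
    open, in the interior of their intersection. *)
Lemma star_dense_bigcap (G : nat -> set Nstar) :
  (forall n, open (G n)) -> (forall n, dense (G n)) -> dense (\bigcap_n G n)°.
Proof.
move=> oG dG U nU oU; have [A0 nA0 A0U] := open_star_sub oU nU.
have [A [[x Ax] AA0 AG]] : exists A, [/\ star A !=set0, star A `<=` star A0 &
    forall n, star A `<=` G n].
  apply: (@generic_star (fun n W => W `<=` G n)) => // [n A nA _|n A B AB BG].
    have [A' nA' A'AG] : exists2 A', star A' !=set0 & star A' `<=` star A `&` G n.
      apply: open_star_sub; first by apply: openI => //; exact: open_star.
      by apply: dG => //; exact: open_star.
    by exists A'; split=> // y /A'AG[].
  exact: subset_trans AB BG.
exists x; split; first exact/A0U/AA0.
by apply: filterS (star_nbhs Ax) => y Ay n _; exact: AG.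
Qed.

(** * Variation of a functional on clopen sets *)

Section functionals.
Variable R : realType.
Local Notation C := (Cspace R Nstar).
Implicit Types (f g : C) (A B D : set nat) (L : C -> R).

Lemma indic_star_continuous A : continuous (\1_(star A) : Nstar -> R).
Proof.
move=> x; have [Ax|nAx] := pselect (star A x).
  apply: (near_cst_continuous (1 : R)); apply: filterS (star_nbhs Ax) => y Ay.
  by rewrite indicE mem_set.
apply: (near_cst_continuous (0 : R)); have : star (~` A) x by rewrite starC.
move=> /star_nbhs; apply: filterS => y; rewrite starC => nAy.
by rewrite indicE memNset.
Qed.

Definition cindic A : C := mkC (@indic_star_continuous A).

Definition cmul f g : C :=
  mkC (fun x => continuousM (@Cspace_continuous R Nstar f x)
                            (@Cspace_continuous R Nstar g x)).

Lemma cindicE A x : cindic A x = (x \in star A)%:R.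
Proof. by rewrite /cindic mkCE indicE. Qed.

Lemma norm_cindic A x : `|cindic A x| <= 1.
Proof. by rewrite cindicE; case: (_ \in _); rewrite ?normr1 ?normr0. Qed.

Lemma cmulE f g x : cmul f g x = f x * g x. Proof. by []. Qed.

Lemma cindic_in A x : star A x -> cindic A x = 1.
Proof. by move=> Ax; rewrite cindicE mem_set. Qed.

Lemma cindic_out A x : ~ star A x -> cindic A x = 0.
Proof. by move=> Ax; rewrite cindicE memNset. Qed.

Lemma cindicC A x : cindic (~` A) x = 1 - cindic A x.
Proof.
have [Ax|nA] := pselect (star A x).
  by rewrite [cindic A x]cindic_in// subrr cindic_out// starC; apply.
by rewrite [cindic A x]cindic_out// subr0 cindic_in// starC.
Qed.

Lemma cindicI A D x : cindic (A `&` D) x = cindic A x * cindic D x.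
Proof.
have [Ax|nA] := pselect (star A x); last first.
  by rewrite [cindic A x]cindic_out// mul0r cindic_out// starI => -[].
rewrite [cindic A x]cindic_in// mul1r; have [Dx|nD] := pselect (star D x).
  by rewrite !cindic_in// starI.
by rewrite !cindic_out// starI => -[].
Qed.

Lemma Cnorm_le f c : 0 <= c -> (forall x, `|f x| <= c) -> `|f| <= c.
Proof. exact: supnorm_le. Qed.

(** Bounded linear functionals on the space of continuous functions, with an
    explicit bound on the norm: a bound common to a family of functionals is
    what makes suprema over the family finite. *)
Definition functional_bound M L := [/\ 0 <= M, forall f g, L (f + g) = L f + L g,
  forall a f, L (a *: f) = a * L f & forall f, `|L f| <= M * `|f|].

Definition supported_unit A f :=
  (forall x, `|f x| <= 1) /\ (forall x, ~ star A x -> f x = 0).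

(** The value at [star A] of the variation of the measure representing [L]. *)
Definition tv L A : R := sup [set L f | f in supported_unit A].

Section tv.
Variables (M : R) (L : C -> R).
Hypothesis LM : functional_bound M L.

Let LD f g : L (f + g) = L f + L g. Proof. by case: LM. Qed.
Let LZ a f : L (a *: f) = a * L f. Proof. by case: LM. Qed.
Let L0 : L 0 = 0. Proof. by rewrite -[0 in LHS](scale0r (0 : C)) LZ mul0r. Qed.
Let LN f : L (- f) = - L f. Proof. by rewrite -scaleN1r LZ mulN1r. Qed.
Let M0 : 0 <= M. Proof. by case: LM. Qed.

Lemma functional_norm c f : 0 <= c -> (forall x, `|f x| <= c) -> `|L f| <= M * c.
Proof.
move=> c0 fc; have [_ _ _ Lf] := LM; apply: le_trans (Lf f) _.
by rewrite ler_wpM2l// Cnorm_le.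
Qed.

Lemma has_sup_tv A : has_sup [set L f | f in supported_unit A].
Proof.
split; first by exists (L 0), 0 => //; split=> x; rewrite ?Cspace0// normr0.
exists M => _ [f [f1 _] <-]; apply: le_trans (ler_norm _) _.
by rewrite -[leRHS]mulr1; exact: functional_norm.
Qed.

Lemma tv_ub A f : supported_unit A f -> L f <= tv L A.
Proof. by move=> Af; apply: ub_le_sup; [exact: (has_sup_tv A).2|exists f]. Qed.

Lemma tv_lub A c : (forall f, supported_unit A f -> L f <= c) -> tv L A <= c.
Proof.
move=> h; apply: ge_sup; first exact: (has_sup_tv A).1.
by move=> _ [f Af <-]; exact: h.
Qed.

Lemma tv_ge0 A : 0 <= tv L A.
Proof. by rewrite -L0 tv_ub//; split=> x; rewrite ?Cspace0 ?normr0. Qed.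

Lemma tv_le A : tv L A <= M.
Proof.
apply: tv_lub => f [f1 _]; apply: le_trans (ler_norm _) _.
by rewrite -[leRHS]mulr1; exact: functional_norm.
Qed.

Lemma tv_mono A B : star A `<=` star B -> tv L A <= tv L B.
Proof.
by move=> AB; apply: tv_lub => f [f1 fA]; apply: tv_ub; split=> // x /(contra_not (AB x))/fA.
Qed.

Lemma tv_null A : star A = set0 -> tv L A = 0.
Proof.
move=> A0; apply/eqP; rewrite eq_le tv_ge0 andbT; apply: tv_lub => f [_ fA].
by rewrite (_ : f = 0) ?L0//; apply: CspaceP => x; rewrite fA// A0.
Qed.

(** A function supported on [star A] is the sum of its restrictions to the two
    parts; conversely two functions in the unit ball with disjoint supports add
    up to one in the unit ball. *)
Lemma tvID A B : tv L A = tv L (A `&` B) + tv L (A `\` B).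
Proof.
apply/eqP; rewrite eq_le; apply/andP; split.
  apply: tv_lub => f [f1 fA].
  have -> : f = cmul f (cindic B) + cmul f (cindic (~` B)).
    by apply: CspaceP => x; rewrite CspaceD !cmulE cindicC; ring.
  rewrite LD lerD// tv_ub//; split=> x.
  - by rewrite cmulE normrM mulr_ile1// norm_cindic.
  - rewrite starI => /not_andP[/fA fx|nB]; first by rewrite cmulE fx mul0r.
    by rewrite cmulE cindicE memNset// mulr0.
  - by rewrite cmulE normrM mulr_ile1// norm_cindic.
  - rewrite setDE starI => /not_andP[/fA fx|nB]; first by rewrite cmulE fx mul0r.
    by rewrite cmulE cindicE memNset// mulr0.
rewrite -lerBrDr; apply: tv_lub => f [f1 fA]; rewrite lerBrDl -lerBrDr.
apply: tv_lub => g [g1 gA]; rewrite lerBrDl addrC -LD; apply: tv_ub.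
split=> x; rewrite CspaceD.
  have [Bx|nBx] := pselect (star B x).
    rewrite (gA x) ?add0r; first exact: f1.
    by rewrite starD => -[_ /(_ Bx)].
  rewrite (fA x) ?addr0; first exact: g1.
  by rewrite starI => -[_ /nBx].
by move=> nA; rewrite (fA x) ?(gA x) ?addr0 ?starD ?starI// => -[].
Qed.

Lemma tv_norm A f c : 0 <= c -> (forall x, `|f x| <= c) ->
  (forall x, ~ star A x -> f x = 0) -> `|L f| <= c * tv L A.
Proof.
move=> c0 fc fA; have [c1|c1] := eqVneq c 0.
  rewrite (_ : f = 0) ?L0 ?normr0 ?mulr_ge0 ?tv_ge0//.
  by apply: CspaceP => x; apply/eqP; rewrite Cspace0 -normr_le0 -c1.
have cgt0 : 0 < c by rewrite lt_def c1.
rewrite -ler_pdivrMl// -[c^-1]gtr0_norm ?invr_gt0// -normrM -LZ.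
have s g : (forall x, `|g x| <= c) -> (forall x, ~ star A x -> g x = 0) ->
    L (c^-1 *: g) <= tv L A.
  move=> gc gA; apply: tv_ub; split=> x; rewrite CspaceZ; last by move=> nA; rewrite gA ?mulr0.
  by rewrite normrM gtr0_norm ?invr_gt0// ler_pdivrMl// mulr1.
rewrite ler_norml s// andbT lerNl -LN -scalerN s// => x; rewrite CspaceN ?normrN//.
by move=> /fA ->; rewrite oppr0.
Qed.

Lemma tv_cindic A : `|L (cindic A)| <= tv L A.
Proof.
rewrite -[leRHS]mul1r; apply: tv_norm => // x; [exact: norm_cindic|exact: cindic_out].
Qed.

(** Approximation by step functions, in geometric form. If [f] takes its values
    between [0] and [c], separate the set where [f] is at least [2c/3] from the
    set where it is at most [c/3] by a clopen [star D]; subtracting [c/3] on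
    [star D] leaves [L f] unchanged and brings the values below [2c/3]. *)
Lemma functional0 : (forall A, L (cindic A) = 0) -> forall f, L f = 0.
Proof.
move=> Lind.
have key n : forall f c, 0 <= c -> (forall x, 0 <= f x <= c) ->
    `|L f| <= M * c * (2 / 3) ^+ n.
  elim: n => [|n IH] f c c0 fc.
    rewrite expr0 mulr1; apply: functional_norm => // x.
    by have /andP[f0 ?] := fc x; rewrite ger0_norm.
  have [c1|c1] := eqVneq c 0.
    (* For [c = 0] the two sets to be separated would not be disjoint. *)
    rewrite (_ : f = 0) ?L0 ?c1 ?normr0 ?mulr0 ?mul0r//.
    by apply: CspaceP => x; apply/eqP; rewrite Cspace0 eq_le andbC -{2}c1.
  have cgt0 : 0 < c by rewrite lt_def c1.
  have [D [fD Df]] : exists D, (f : Nstar -> R) @^-1` [set r | 2 * c / 3 <= r] `<=` star D /\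
      star D `<=` (f : Nstar -> R) @^-1` [set r | c / 3 < r].
    apply: star_separation.
    - apply: closed_comp; [by move=> x _; exact: Cspace_continuous|exact: closed_ge].
    - apply: open_comp; [by move=> x _; exact: Cspace_continuous|exact: open_gt].
    - by move=> x /=; lra.
  have -> : L f = L (f - (c / 3) *: cindic D) by rewrite LD LN LZ Lind mulr0 subr0.
  apply: le_trans (IH _ (2 * c / 3) _ _) _; first by lra.
    move=> x; rewrite CspaceD CspaceN CspaceZ; have /andP[fx0 fxc] := fc x.
    have [Dx|nDx] := pselect (star D x).
      by rewrite cindic_in//; have /= := Df _ Dx; lra.
    have : ~~ (2 * c / 3 <= f x) by apply/negP => /fD.
    by rewrite cindic_out// -ltNge; lra.
  by rewrite exprS le_eqVlt; apply/orP; left; apply/eqP; field.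
have pos f c : 0 <= c -> (forall x, 0 <= f x <= c) -> L f = 0.
  move=> c0 fc; apply/eqP; rewrite -normr_le0.
  have cv : (fun n => M * c * (2 / 3) ^+ n) @ \oo --> (M * c * 0 : R).
    by apply: cvgMr; apply: cvg_expr; rewrite ger0_norm; lra.
  rewrite mulr0 in cv; rewrite -(cvg_lim _ cv)//.
  apply: limr_ge; first by apply/cvg_ex; exists 0.
  by near=> n; exact: key.
move=> f; have -> : f = (f + `|f| *: cindic setT) - `|f| *: cindic setT by rewrite addrK.
rewrite LD LN LZ Lind mulr0 subr0; apply: (@pos _ (`|f| + `|f|)) => [|x].
  by rewrite addr_ge0.
have := @le_supnorm _ _ f x; rewrite -[supnorm f]/(`|f|) ler_norml => /andP[h1 h2].
by rewrite CspaceD CspaceZ cindic_in ?starT// mulr1 lerD2r h2 andbT -lerBlDr sub0r.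
Unshelve. all: by end_near. Qed.

(** The support of a nonzero measure is not empty: the sets carrying all the
    variation on [A] form a filter, and every ultrafilter refining it is a
    point as required. Finite sets are null, so that this ultrafilter is not
    principal. *)
Lemma tv_support A : 0 < tv L A ->
  exists2 x, star A x & forall D, star D x -> 0 < tv L (A `&` D).
Proof.
move=> A0.
pose F : set_system nat := [set D | tv L (A `\` D) = 0].
have FP : ProperFilter F.
  split; first by rewrite /F/= setD0 => h; rewrite h ltxx in A0.
  split=> [|D E FD FE|D E DE FD].
  - by rewrite /F/= setDT tv_null// star0.
  - rewrite /F/= (tvID _ D).
    apply/eqP; rewrite eq_le addr_ge0 ?tv_ge0// andbT -[leRHS]addr0.
    rewrite lerD//; first rewrite -FE; last rewrite -FD; apply: tv_mono; apply: star_sub => n /=.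
      by move=> [[An nDE] Dn]; split=> // En; apply: nDE.
    by move=> [[An nDE] Dn]; split.
  - apply/eqP; rewrite eq_le tv_ge0 andbT -FD; apply: tv_mono; apply: star_sub => n /=.
    by move=> [An nE]; split=> // /DE.
have [G [GU FG]] := ultraFilterLemma FP.
have GF D : finite_set D -> ~ G D.
  move=> fD GD; apply: (filter_not_empty G).
  rewrite -(setICr D); apply: filterI => //; apply: FG.
  rewrite /F/= tv_null// setDE setCK; apply/eqP; apply: contrapT => /negP/set0P/star_neq0.
  by apply; apply: sub_finite_set fD => n [].
have h : (~` range principal) (BetaN GU).
  move=> [n _ /(congr1 ultra)/= Gn].
  by apply: (GF [set n]); [exact: finite_set1|rewrite -Gn; exact/principalE].
exists (SigSub (mem_set h)).
  by apply/starE; apply: FG; rewrite /F/= setDv tv_null// star0.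
move=> D /starE/= GD; rewrite lt_def tv_ge0 andbT; apply/eqP => AD.
apply: (filter_not_empty G); rewrite -(setICr D); apply: filterI => //; apply: FG.
by rewrite /F/= setDE setCK.
Qed.

End tv.

(** On indicator functions both sides agree because [star D] either contains
    [x] and carries all the mass of [A], or misses [x] and carries none;
    [functional0] extends the equality to all continuous functions. *)
Lemma functional_dirac M L A x : functional_bound M L -> star A x ->
  (forall D, star D x -> tv L (A `\` D) = 0) ->
  forall f, (forall z, ~ star A z -> f z = 0) -> L f = f x * L (cindic A).
Proof.
move=> LM Ax Lx; have [M0 LD LZ Lb] := LM.
pose La f := L (cmul f (cindic A)) - f x * L (cindic A).
have cmulD f g : cmul (f + g) (cindic A) = cmul f (cindic A) + cmul g (cindic A).
  by apply: CspaceP => z; rewrite CspaceD !cmulE mulrDl.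
have cmulZ a f : cmul (a *: f) (cindic A) = a *: cmul f (cindic A).
  by apply: CspaceP => z; rewrite CspaceZ !cmulE mulrA.
have Lab : functional_bound (M + `|L (cindic A)|) La.
  split.
  - by rewrite addr_ge0.
  - by move=> f g; rewrite /La cmulD LD CspaceD; ring.
  - by move=> a f; rewrite /La cmulZ LZ CspaceZ; ring.
  - move=> f; rewrite /La (le_trans (ler_normB _ _))// mulrDl lerD//.
      apply: functional_norm => // z; rewrite cmulE normrM -[leRHS]mulr1.
      rewrite ler_pM//; first exact: le_supnorm.
      by exact: norm_cindic.
    by rewrite normrM mulrC ler_wpM2l//; exact: le_supnorm.
have La0 : forall f, La f = 0.
  apply: functional0 Lab _ => D.
  have DA : cmul (cindic D) (cindic A) = cindic (A `&` D).
    by apply: CspaceP => z; rewrite cmulE cindicI mulrC.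
  have [Dx|nDx] := pselect (star D x).
    rewrite /La DA cindic_in// mul1r.
    have -> : cindic A = cindic (A `&` D) + cindic (A `\` D).
      by apply: CspaceP => z; rewrite CspaceD setDE !cindicI cindicC; ring.
    rewrite LD opprD addrA subrr sub0r; apply/eqP; rewrite oppr_eq0 -normr_le0.
    by rewrite -(Lx _ Dx); exact: tv_cindic LM _.
  rewrite /La DA cindic_out// mul0r subr0; apply/eqP; rewrite -normr_le0.
  have nDx' : star (~` D) x by rewrite starC.
  rewrite -(Lx _ nDx') setDE setCK; exact: tv_cindic LM _.
move=> f fA; have := La0 f; rewrite /La => /eqP; rewrite subr_eq0 => /eqP <-.
congr L; apply: CspaceP => z; rewrite cmulE.
have [Az|/[dup] nAz /fA ->] := pselect (star A z); last by rewrite mul0r.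
by rewrite cindic_in// mulr1.
Qed.

End functionals.

(** * Radon measures from finitely additive contents *)

Section content.
Variable R : realType.

(** The monotonicity of a content with respect to inclusion of clopen sets, not
    of sets of integers, relies on the last field, which says that finite sets
    are null. *)
Record star_content := StarContent {
  content_fun :> set nat -> R;
  content_ge0 : forall A, 0 <= content_fun A;
  contentID : forall A B, content_fun A = content_fun (A `&` B) + content_fun (A `\` B);
  content_null : forall A, star A = set0 -> content_fun A = 0 }.

Variable p : star_content.
Implicit Types (A B : set nat) (U V E : set Nstar).

Lemma content_mono A B : star A `<=` star B -> p A <= p B.
Proof.
move=> AB; rewrite (contentID p A B) (contentID p B A) setIC.
rewrite [p (A `\` B)]content_null ?addr0 ?lerDl ?content_ge0//.
by rewrite starD setD_eq0.
Qed.

Lemma contentU A B : star A `&` star B = set0 -> p (A `|` B) = p A + p B.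
Proof.
move=> AB; rewrite (contentID p _ A) setUK; congr (_ + _).
have BA : star B `<=` ~` star A.
  by move=> x Bx Ax; have : (star A `&` star B) x by []; rewrite AB.
apply/eqP; rewrite eq_le; apply/andP; split; apply: content_mono.
  by rewrite starD starU => x [[]].
by rewrite starD starU => x Bx; split; [right|exact: BA].
Qed.

Definition inner_content U : R := sup [set p A | A in [set A | star A `<=` U]].

Lemma has_sup_inner_content U : has_sup [set p A | A in [set A | star A `<=` U]].
Proof.
split; first by exists (p set0), set0 => //=; rewrite star0.
by exists (p setT) => _ [A _ <-]; apply: content_mono; rewrite starT.
Qed.

Lemma inner_content_ub A U : star A `<=` U -> p A <= inner_content U.
Proof. by move=> AU; apply: ub_le_sup; [exact: (has_sup_inner_content U).2|exists A]. Qed.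

Lemma inner_content_lub U c : (forall A, star A `<=` U -> p A <= c) -> inner_content U <= c.
Proof.
move=> h; apply: ge_sup; first exact: (has_sup_inner_content U).1.
by move=> _ [A AU <-]; exact: h.
Qed.

Lemma inner_content_adherent U e : 0 < e -> exists2 A, star A `<=` U & inner_content U - e < p A.
Proof.
by move=> e0; have [_ [A AU <-] h] := sup_adherent e0 (has_sup_inner_content U); exists A.
Qed.

Lemma inner_content_mono U V : U `<=` V -> inner_content U <= inner_content V.
Proof.
by move=> UV; apply: inner_content_lub => A AU; apply: inner_content_ub; exact: subset_trans UV.
Qed.

Lemma inner_content_star A : inner_content (star A) = p A.
Proof.
apply/eqP; rewrite eq_le inner_content_ub// andbT; apply: inner_content_lub => B; exact: content_mono.
Qed.

Lemma inner_content_ge0 U : 0 <= inner_content U.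
Proof. by rewrite (le_trans (content_ge0 p set0))// inner_content_ub// star0. Qed.

(** Clopen separation splits [A] along the open sets, one at a time. *)
Lemma content_bigcup_fin (U : nat -> set Nstar) N A : (forall n, open (U n)) ->
  star A `<=` \bigcup_(i < N) U i -> p A <= \sum_(i < N) inner_content (U i).
Proof.
move=> oU; elim: N A => [|N IH] A; rewrite ?II0.
  rewrite bigcup_set0 subset0 => A0.
  by rewrite big_ord0 content_null.
move=> AU; set V := \bigcup_(i < N) U i.
have [C [AC CU]] : exists C, star A `\` V `<=` star C /\ star C `<=` U N.
  apply: star_separation => //.
    rewrite setDE; apply: closedI; first exact: closed_star.
    by apply: open_closedC; exact: bigcup_open.
  move=> x [Ax nV]; have [i /= + Uix] := AU _ Ax; rewrite ltnS leq_eqVlt.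
  by move=> /predU1P[<-//|iN]; exfalso; apply: nV; exists i.
rewrite big_ord_recr/= addrC (contentID p A C) lerD//.
  apply: inner_content_ub; apply: subset_trans CU; rewrite starI; exact: subIsetr.
apply: IH => x; rewrite starD => -[Ax nC]; apply: contrapT => nV.
by apply: nC; apply: AC.
Qed.

Lemma content_bigcup (U : nat -> set Nstar) A : (forall n, open (U n)) ->
  star A `<=` \bigcup_i U i -> exists N, p A <= \sum_(i < N) inner_content (U i).
Proof.
move=> oU AU; have cA : compact (star A).
  by apply: (subclosed_compact (@closed_star A) (@compact_setT Nstar)).
move: cA; rewrite compact_cover => /(_ nat setT U) [n _ //|//|D _ AD].
exists (\max_(i <- finmap.enum_fset D) i).+1; apply: content_bigcup_fin => // x /AD[i /= iD Ux].
by exists i => //=; rewrite ltnS; apply: leq_bigmax_seq.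
Qed.

Definition outer_content E : R := inf [set inner_content U | U in [set U | open U /\ E `<=` U]].

Lemma has_inf_outer_content E : has_inf [set inner_content U | U in [set U | open U /\ E `<=` U]].
Proof.
split; first by exists (inner_content setT), setT => //; split=> //; exact: openT.
by exists 0 => _ [U _ <-]; exact: inner_content_ge0.
Qed.

Lemma outer_content_lb E U : open U -> E `<=` U -> outer_content E <= inner_content U.
Proof. by move=> oU EU; apply: ge_inf; [exact: (has_inf_outer_content E).2|exists U]. Qed.

Lemma outer_content_adherent E e : 0 < e ->
  exists U, [/\ open U, E `<=` U & inner_content U < outer_content E + e].
Proof.
by move=> e0; have [_ [U [oU EU] <-] h] := inf_adherent e0 (has_inf_outer_content E); exists U.
Qed.

Lemma outer_content_ge0 E : 0 <= outer_content E.
Proof.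
apply: lb_le_inf; first exact: (has_inf_outer_content E).1.
by move=> _ [U _ <-]; exact: inner_content_ge0.
Qed.

Lemma outer_content_mono E F : E `<=` F -> outer_content E <= outer_content F.
Proof.
move=> EF; apply: lb_le_inf; first exact: (has_inf_outer_content F).1.
by move=> _ [U [oU FU] <-]; apply: outer_content_lb => //; exact: subset_trans FU.
Qed.

Lemma outer_content_open U : open U -> outer_content U = inner_content U.
Proof.
move=> oU; apply/eqP; rewrite eq_le outer_content_lb//=.
apply: lb_le_inf; first exact: (has_inf_outer_content U).1.
by move=> _ [V [oV UV] <-]; exact: inner_content_mono.
Qed.

Definition content_outer_measure E : \bar R := (outer_content E)%:E.

Lemma content_outer_measure0 : content_outer_measure set0 = 0%E.
Proof.
rewrite /content_outer_measure outer_content_open; last exact: open0.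
by rewrite -star0 inner_content_star content_null// star0.
Qed.

Lemma content_outer_measure_ge0 E : (0 <= content_outer_measure E)%E.
Proof. by rewrite lee_fin outer_content_ge0. Qed.

Lemma content_outer_measure_mono : {homo content_outer_measure : E F / E `<=` F >-> (E <= F)%E}.
Proof. by move=> E F EF; rewrite lee_fin outer_content_mono. Qed.

Lemma content_outer_measure_sigma_subadditive : sigma_subadditive content_outer_measure.
Proof.
move=> F; apply/lee_addgt0Pr => e e0.
have /choice[U UP] : forall n, exists U, [/\ open U, F n `<=` U &
    inner_content U < outer_content (F n) + e / (2 ^ n.+1)%:R].
  by move=> n; apply: outer_content_adherent; rewrite divr_gt0// ltr0n expn_gt0.
have oU n : open (U n) by have [] := UP n.
apply: (le_trans _ (epsilon_trick xpredT (fun n => content_outer_measure_ge0 (F n)) (ltW e0))).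
have UF : \bigcup_n F n `<=` \bigcup_n U n.
  by move=> x [n _ Fx]; exists n => //; have [_ + _] := UP n; apply.
apply: (@le_trans _ _ (inner_content (\bigcup_n U n))%:E).
  by rewrite lee_fin outer_content_lb//; apply: bigcup_open.
(* The partial sums bound [inner_content] of the union only if the series is
   finite; otherwise there is nothing to prove. *)
have [e1|] := leP (inner_content (\bigcup_n U n))%:E
  (\sum_(0 <= i <oo) (content_outer_measure (F i) + (e / (2 ^ i.+1)%:R)%:E))%E; first by [].
set S := (\sum_(0 <= i <oo) _)%E => Slt; exfalso.
have S0 : (0 <= S)%E.
  apply: nneseries_ge0 => n _ _; rewrite adde_ge0 ?content_outer_measure_ge0// lee_fin.
  by rewrite divr_ge0// ltW.
have Sfin : S \is a fin_num by rewrite ge0_fin_numE// (lt_le_trans Slt) ?leey.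
suff : (inner_content (\bigcup_n U n) <= fine S) by rewrite leNgt -lte_fin fineK// Slt.
apply: inner_content_lub => A AU; have [N] := content_bigcup oU AU.
move=> /le_trans; apply; rewrite -lee_fin fineK// -sumEFin.
apply: (@le_trans _ _ (\sum_(0 <= i < N) (content_outer_measure (F i) + (e / (2 ^ i.+1)%:R)%:E))%E).
  rewrite big_mkord; apply: lee_sum => i _; rewrite -EFinD lee_fin.
  by have [_ _ /ltW] := UP i.
apply: nneseries_lim_ge => n _ _; rewrite adde_ge0 ?content_outer_measure_ge0// lee_fin.
by rewrite divr_ge0// ltW.
Qed.

HB.instance Definition _ := isOuterMeasure.Build R Nstar content_outer_measure
  content_outer_measure0 content_outer_measure_ge0 content_outer_measure_mono
  content_outer_measure_sigma_subadditive.

(** Approximate the trace of an open set on [U] from inside by a clopen set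
    [A]; the rest of the test set is covered by the open set minus [A], to
    which inner approximation applies again. *)
Lemma open_caratheodory U : open U -> content_outer_measure.-caratheodory U.
Proof.
move=> oU; apply: le_caratheodory_measurable => E.
rewrite -EFinD lee_fin; apply/ler_addgt0Pr => e e0.
have e3 : 0 < e / 3 by rewrite divr_gt0.
have [W [oW EW lW]] := outer_content_adherent E e3.
have [A AWU pA] := inner_content_adherent (W `&` U) e3.
have [C CWA pC] := inner_content_adherent (W `\` star A) e3.
have h1 : outer_content (E `&` U) <= inner_content (W `&` U).
  by apply: outer_content_lb; [exact: openI|exact: setSI].
have h2 : outer_content (E `&` ~` U) <= inner_content (W `\` star A).
  apply: outer_content_lb.
    by rewrite setDE; apply: openI => //; exact/closed_openC/closed_star.
  by move=> x [/EW Wx nU]; split=> // /AWU[].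
have h3 : p A + p C <= inner_content W.
  rewrite -contentU; last first.
    by apply/seteqP; split=> // x [Ax /CWA[_]].
  by apply: inner_content_ub; rewrite starU => x [/AWU[]|/CWA[]].
by lra.
Qed.

(** The Borel sets of the remainder are not generated by its clopen sets, as an
    open set need not be a countable union of clopen sets; so the open sets
    themselves have to be measurable. *)
Lemma Borel_caratheodory (E : set (Borel Nstar)) :
  measurable E -> content_outer_measure.-caratheodory E.
Proof.
suff : <<s @open Nstar >> `<=` content_outer_measure.-caratheodory by apply.
apply: smallest_sub; last by move=> U; exact: open_caratheodory.
exact: (@sigma_algebra_measurable _ (caratheodory_type content_outer_measure)).
Qed.

Definition radon_measure : set (Borel Nstar) -> \bar R := content_outer_measure.

Lemma radon_measure0 : radon_measure set0 = 0%E.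
Proof. exact: content_outer_measure0. Qed.

Lemma radon_measure_ge0 E : (0 <= radon_measure E)%E.
Proof. exact: content_outer_measure_ge0. Qed.

Lemma radon_measure_sigma_additive : semi_sigma_additive radon_measure.
Proof.
move=> F mF tF mUF; apply: (@caratheodory_measure_sigma_additive _ _ content_outer_measure F) => //.
  by move=> n; exact: Borel_caratheodory.
exact: Borel_caratheodory.
Qed.

HB.instance Definition _ := isMeasure.Build _ (Borel Nstar) R radon_measure
  radon_measure0 radon_measure_ge0 radon_measure_sigma_additive.

Lemma radon_measure_fin : fin_num_fun radon_measure. Proof. by []. Qed.

HB.instance Definition _ := @Measure_isFinite.Build _ (Borel Nstar) R
  radon_measure radon_measure_fin.

Lemma radon_measure_star A : radon_measure (star A) = (p A)%:E.
Proof. by rewrite /radon_measure /content_outer_measure outer_content_open ?inner_content_star//; exact: open_star. Qed.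

Lemma open_Borel U : open U -> @measurable _ (Borel Nstar) U.
Proof. by move=> oU; exact: sub_sigma_algebra. Qed.

(** Outer regularity of the complement. *)
Lemma radon_measure_inner (E : set (Borel Nstar)) (e : R) : measurable E -> 0 < e ->
  exists K, [/\ closed (K : set Nstar), K `<=` E & (radon_measure (E `\` K) <= e%:E)%E].
Proof.
move=> mE e0; have [U [oU EU lU]] := outer_content_adherent (~` E) e0.
exists (~` U); split; first exact: open_closedC.
  by move=> x nU; apply: contrapT => nE; apply: nU; exact: EU.
have mU := open_Borel oU; have mnE := measurableC mE.
have UE : E `\` ~` U = U `\` ~` E by rewrite !setDE !setCK setIC.
rewrite UE; have := measureDI radon_measure mU mnE.
rewrite (setIidr EU) /= /radon_measure /content_outer_measure -EFinD => -[].
by rewrite outer_content_open// lee_fin; lra.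
Qed.

End content.

(** * Representing functionals by Radon charges *)

Lemma Nstar_hausdorff : hausdorff_space Nstar.
Proof.
move=> x y clxy; apply: contrapT => xy; apply: xy.
apply: val_inj; apply: betaN_eq; apply/esym.
apply: (@max_filter _ _ (ultraP (set_val x))) => A xA.
apply: contrapT => /betaNC yA.
have [z [/starE zA /starE/betaNC]] : star A `&` star (~` A) !=set0.
  by apply: clxy; apply: star_nbhs; exact/starE.
exact.
Qed.

Lemma functional_boundB (R : realType) M1 M2 (L1 L2 : Cspace R Nstar -> R) :
  functional_bound M1 L1 -> functional_bound M2 L2 ->
  functional_bound (M1 + M2) (fun f => L1 f - L2 f).
Proof.
move=> [M10 D1 Z1 B1] [M20 D2 Z2 B2]; split.
- exact: addr_ge0.
- by move=> f g; rewrite D1 D2; ring.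
- by move=> a f; rewrite Z1 Z2; ring.
- by move=> f; rewrite (le_trans (ler_normB _ _))// mulrDl lerD.
Qed.

Section integration.
Variable R : realType.
Local Notation C := (Cspace R Nstar).

Lemma Cspace_measurable (f : C) :
  measurable_fun [set: Borel Nstar] (f : Borel Nstar -> R).
Proof.
apply: (measurability _ (RGenOInfty.measurableE R)).
move=> _ [_ [a ->] <-]; apply: measurableI => //; apply: open_Borel.
rewrite preimage_itvoy.
change (open ((f : Nstar -> R) @^-1` [set r | a < r])).
apply: open_comp; last exact: open_gt.
by move=> x _; exact: Cspace_continuous.
Qed.

Lemma Cspace_emeasurable (f : C) :
  measurable_fun [set: Borel Nstar] (EFin \o (f : Borel Nstar -> R)).
Proof. by apply/measurable_EFinP; exact: Cspace_measurable. Qed.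

Section finite_measure.
Variable m : {finite_measure set (Borel Nstar) -> \bar R}.

Lemma Cspace_integrable (f : C) : m.-integrable setT (EFin \o (f : Borel Nstar -> R)).
Proof.
apply: measurable_bounded_integrable => //.
- by rewrite ltey_eq fin_num_measure.
- exact: Cspace_measurable.
- exists `|f|; split=> // M fM x _; apply: le_trans (ltW fM).
  exact: le_supnorm.
Qed.

Definition Cint (f : C) : R := (\int[m]_x f x)%R.

Lemma CintD f g : Cint (f + g) = Cint f + Cint g.
Proof. by rewrite /Cint -RintegralD//; exact: Cspace_integrable. Qed.

Lemma CintZ a f : Cint (a *: f) = a * Cint f.
Proof. by rewrite /Cint -RintegralZl//; exact: Cspace_integrable. Qed.

Lemma Cint_le f : `|Cint f| <= fine (m setT) * `|f|.
Proof.
apply: le_trans (le_normr_Rintegral _ (Cspace_integrable f)) _ => //.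
rewrite mulrC -Rintegral_cst//; apply: le_Rintegral => //.
- exact/integrable_norm/Cspace_integrable.
- exact: finite_measure_integrable_cst.
- by move=> x _; exact: le_supnorm.
Qed.

Lemma Cint_indic A : Cint (cindic R A) = fine (m (star A)).
Proof.
rewrite /Cint /Rintegral; congr fine.
rewrite (_ : (fun x => _) = EFin \o \1_(star A))// integral_indic ?setIT//.
by apply: open_Borel; exact: open_star.
Qed.

Lemma Cint_bound : functional_bound (fine (m setT)) Cint.
Proof.
split; [exact: fine_ge0|exact: CintD|exact: CintZ|exact: Cint_le].
Qed.

End finite_measure.

Lemma fin_num_sub_eq (x y z w : \bar R) : x \is a fin_num -> y \is a fin_num ->
  z \is a fin_num -> w \is a fin_num -> (x - y = z - w)%E -> (x + w = z + y)%E.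
Proof.
case: x => // a; case: y => // b; case: z => // c; case: w => // d _ _ _ _ [h].
have e : a + d = c + b by lra.
exact: (congr1 EFin e).
Qed.

(** The positive and negative parts in the definition of the integral are those
    of the Jordan decomposition; any other way of writing the charge as a
    difference of finite measures gives the same integral, since the cross sums
    of the measures agree. *)
Lemma charge_integralE (nu : {charge set (Borel Nstar) -> \bar R})
    (m n : {finite_measure set (Borel Nstar) -> \bar R}) :
  (forall E, measurable E -> nu E = (m E - n E)%E) ->
  forall f, charge_integral nu f = Cint m f - Cint n f.
Proof.
move=> numn f; rewrite /charge_integral.
set jp := jordan_pos (hahnP nu); set jn := jordan_neg (hahnP nu).
suff : Cint jp f + Cint n f = Cint m f + Cint jn f by rewrite /Cint; lra.
have add (k l : {finite_measure set (Borel Nstar) -> \bar R}) :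
    Cint k f + Cint l f = fine (\int[measure_add k l]_x (f x)%:E)%E.
  rewrite /Cint /Rintegral integral_measure_add//.
  - apply/esym/fineD; apply: integrable_fin_num => //; exact: Cspace_integrable.
  - exact: Cspace_integrable.
  - exact: Cspace_integrable.
rewrite !add; congr fine; apply: eq_measure_integral => E mE _.
transitivity (jp E + n E)%E; first exact: measure_addE.
apply: etrans; last by apply/esym; exact: measure_addE.
have jE : (jp E - jn E = m E - n E)%E.
  by rewrite -numn// (jordan_decomp (hahnP nu) mE) /cadd /= cscaleN1.
by apply: fin_num_sub_eq jE; exact: fin_num_measure.
Qed.

Lemma charge_integral_delta y (f : C) : charge_integral (delta R y) f = f y.
Proof.
rewrite (@charge_integralE _ (@dirac _ (Borel Nstar) y R) mzero).
  rewrite /Cint /Rintegral integral_dirac//=; last first.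
    exact: (Cspace_emeasurable f).
  by rewrite integral_measure_zero indicT mul1r subr0.
by move=> E _; rewrite /mzero sube0.
Qed.

Section content_charge.
Variables p q : star_content R.
Implicit Types E : set (Borel Nstar).

(** The two measures may overlap, so that they only bound the variation of the
    charge from above. *)
Definition content_charge : {charge set (Borel Nstar) -> \bar R} :=
  cadd (charge_of_finite_measure (radon_measure p))
       (copp (charge_of_finite_measure (radon_measure q))).

Lemma content_chargeE E :
  content_charge E = (radon_measure p E - radon_measure q E)%E.
Proof. by []. Qed.

Lemma variation_content_charge E : measurable E ->
  (Defs.variation content_charge E <= radon_measure p E + radon_measure q E)%E.
Proof.
move=> mE; have [[mP _] [mN _] _ _] := hahnP content_charge.
apply: (@leeD R (jordan_pos _ E) _ (jordan_neg _ E)).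
  rewrite jordan_posE cjordan_posE /crestr0 mem_set// /crestr.
  apply: (@le_trans _ _ (radon_measure p (E `&` hahn_pos content_charge))).
    rewrite content_chargeE -[leRHS]sube0 leeB//.
  exact: measureIl.
rewrite jordan_negE cjordan_negE /crestr0 mem_set// /crestr.
apply: (@le_trans _ _ (radon_measure q (E `&` hahn_neg content_charge))).
  rewrite content_chargeE fin_num_oppeB; last by apply: fin_num_measure; exact: measurableI.
  by rewrite addeC -[leRHS]sube0 leeB.
exact: measureIl.
Qed.

(** Both measures are inner regular with respect to closed sets, and their sum
    bounds the variation, which therefore is inner regular too. *)
Lemma content_charge_Radon : Radon content_charge.
Proof.
move=> E mE; apply/eqP; rewrite eq_le; apply/andP; split; last first.
  apply: ge_ereal_sup => _ [K [cK KE] <-].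
  have mK : @measurable _ (Borel Nstar) K.
    rewrite -[K]setCK; apply: measurableC; apply: open_Borel; apply: closed_openC.
    exact: compact_closed Nstar_hausdorff cK.
  by apply: le_measure; rewrite ?inE.
apply/lee_addgt0Pr => e e0.
have e2 : 0 < e / 2 by rewrite divr_gt0.
have [K [cK KE pK]] := radon_measure_inner p mE e2.
have [H [cH HE qH]] := radon_measure_inner q mE e2.
have mc (F : set Nstar) : closed F -> @measurable _ (Borel Nstar) F.
  by move=> cF; rewrite -[F]setCK; apply: measurableC; apply: open_Borel; exact: closed_openC.
have mKH : @measurable _ (Borel Nstar) (K `|` H) by apply: measurableU; exact: mc.
rewrite (measureDI (Defs.variation content_charge) mE mKH) addeC leeD//.
  apply: ereal_sup_ubound; exists (K `|` H).
    split; last by rewrite subUset.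
    apply: (subclosed_compact _ (@compact_setT Nstar)) => //.
    exact: closedU.
  by congr (Defs.variation _ _); rewrite setIidr// subUset.
apply: le_trans (variation_content_charge (measurableD mE mKH)) _.
rewrite [e in leRHS]splitr EFinD; apply: leeD.
  apply: le_trans pK; apply: le_measure; rewrite ?inE.
  - exact: measurableD.
  - by apply: measurableD => //; exact: mc.
  - by apply: setDS; exact: subsetUl.
apply: le_trans qH; apply: le_measure; rewrite ?inE.
- exact: measurableD.
- by apply: measurableD => //; exact: mc.
- by apply: setDS; exact: subsetUr.
Qed.

Lemma content_charge_concentrated (G : set Nstar) : open G ->
  (forall A, star A `<=` G -> p A = 0 /\ q A = 0) ->
  concentrated content_charge (~` G).
Proof.
move=> oG G0; exists G; split; [exact: open_Borel| |by rewrite setCK].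
have mG := open_Borel oG.
apply/eqP; rewrite eq_le measure_ge0 andbT.
apply: le_trans (variation_content_charge mG) _.
rewrite /radon_measure /content_outer_measure !outer_content_open// -EFinD lee_fin.
by rewrite -[leRHS]addr0 lerD//; apply: inner_content_lub => A /G0[pA qA]; rewrite ?pA ?qA.
Qed.

End content_charge.

Section riesz.
Variables (M : R) (L : C -> R).
Hypothesis LM : functional_bound M L.

Definition tv_content : star_content R :=
  @StarContent R (tv L) (tv_ge0 LM) (tvID LM) (tv_null LM).

(** With [tv L], the second of two nonnegative contents whose difference is the
    signed content [A |-> L 1_A]. *)
Lemma tvB_ge0 A : 0 <= tv L A - L (cindic R A).
Proof. by rewrite subr_ge0 (le_trans (ler_norm _)) ?(tv_cindic LM). Qed.

Lemma tvB_ID A B : tv L A - L (cindic R A) =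
  (tv L (A `&` B) - L (cindic R (A `&` B))) +
  (tv L (A `\` B) - L (cindic R (A `\` B))).
Proof.
rewrite (tvID LM A B); have -> : cindic R A = cindic R (A `&` B) + cindic R (A `\` B).
  by apply: CspaceP => x; rewrite CspaceD setDE !cindicI cindicC; ring.
by have [_ -> _ _] := LM; ring.
Qed.

Lemma tvB_null A : star A = set0 -> tv L A - L (cindic R A) = 0.
Proof.
move=> A0; rewrite (tv_null LM A0) sub0r; apply/eqP; rewrite oppr_eq0 -normr_le0.
by rewrite -(tv_null LM A0) (tv_cindic LM).
Qed.

Definition tvB_content : star_content R :=
  @StarContent R (fun A => tv L A - L (cindic R A)) tvB_ge0 tvB_ID tvB_null.

Definition riesz_charge := content_charge tv_content tvB_content.

Lemma riesz_charge_star A : riesz_charge (star A) = (L (cindic R A))%:E.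
Proof.
by rewrite /riesz_charge content_chargeE !radon_measure_star/= -EFinB; congr EFin; ring.
Qed.

(** Integration against the charge and [L] agree on indicator functions of
    clopen sets by construction, so that [functional0] applies to their
    difference. *)
Lemma riesz_charge_integral f : charge_integral riesz_charge f = L f.
Proof.
rewrite (@charge_integralE _ (radon_measure tv_content) (radon_measure tvB_content))//.
have LB := functional_boundB (functional_boundB (Cint_bound (radon_measure tv_content))
  (Cint_bound (radon_measure tvB_content))) LM.
apply/eqP; rewrite -subr_eq0; apply/eqP; apply: (functional0 LB) => A.
rewrite !Cint_indic [X in X - _ - _](congr1 fine (radon_measure_star tv_content A)).
rewrite [X in _ - X - _](congr1 fine (radon_measure_star tvB_content A))/=; ring.
Qed.

End riesz.

End integration.

(** * The adjoint images of a fountainless operator *)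

Section operator.
Variable R : realType.
Local Notation C := (Cspace R Nstar).
Variable T : {linear C -> C}.

Lemma bounded_operator_functional : bounded_operator T ->
  exists M, forall y, functional_bound M (fun f => T f y).
Proof.
move=> [M TM]; exists `|M| => y; split=> //.
- by move=> f g; rewrite linearD.
- by move=> a f; rewrite linearZ.
- move=> f; apply: le_trans (le_supnorm _ _) _; apply: le_trans (TM f) _.
  by rewrite ler_wpM2r// ler_norm.
Qed.

Variable M : R.
Hypothesis TM : forall y, functional_bound M (fun f => T f y).
Hypothesis Tf : fountainless T.

Local Notation t y := (tv (fun f => T f y)).

(** Otherwise all [y] in [W] would have a nonzero adjoint image concentrated on
    the complement of [G], which is nowhere dense, although [W] is open and not
    empty. *)
Lemma fountainless_tv (G W : set Nstar) : open G -> dense G ->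
  open W -> W !=set0 -> (forall y, W y -> exists f, T f y != 0) ->
  exists y A, [/\ W y, star A `<=` G & 0 < t y A].
Proof.
move=> oG dG oW [y0 Wy0] nz; apply: contrapT => h.
have t0 y A : W y -> star A `<=` G -> t y A = 0.
  move=> Wy AG; apply/eqP; rewrite eq_le (tv_ge0 (TM y)) andbT leNgt.
  by apply/negP => tA; apply: h; exists y, A.
have ndF : nowhere_dense (~` G).
  rewrite /nowhere_dense -(closure_id _).1; last exact: open_closedC.
  rewrite -subset0 => x; rewrite /interior => /nbhs_Nstar[A Ax AG].
  have [z [Az Gz]] : star A `&` G !=set0.
    by apply: dG; [exists x|exact: open_star].
  exact: AG Az Gz.
have := Tf ndF; rewrite /nowhere_dense -subset0 => /(_ y0); apply.
apply: (@filterS _ (nbhs y0) _ W); last exact: open_nbhs_nbhs.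
move=> y Wy; apply: subset_closure => /=.
exists (riesz_charge (TM y)); split.
- split; first exact: content_charge_Radon.
  by move=> f; rewrite (riesz_charge_integral (TM y)) charge_integral_delta.
- apply: contrapT => nn; have [f] := nz _ Wy; apply/negP; rewrite negbK; apply/eqP.
  apply: (functional0 (TM y)) => A; apply: contrapT => LA; apply: nn.
  exists (star A); first by apply: open_Borel; exact: open_star.
  by rewrite (riesz_charge_star (TM y)) eqe; exact/eqP.
- apply: content_charge_concentrated => // A AG /=; split; first exact: t0.
  rewrite t0// sub0r; apply/eqP; rewrite oppr_eq0 -normr_le0 -(t0 y A)//.
  exact: (tv_cindic (TM y)).
Qed.

End operator.

(** * Energy and two-valued variation *)

Section variation_of_operator.
Variable R : realType.
Local Notation C := (Cspace R Nstar).
Variable T : {linear C -> C}.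
Variable M : R.
Hypothesis TM : forall y, functional_bound M (fun f => T f y).

Local Notation t y := (tv (fun f => T f y)).
Implicit Types (A B D P : set nat) (y z : Nstar) (s : seq (set nat)).

Let t0 y A : 0 <= t y A. Proof. exact: (tv_ge0 (TM y)). Qed.
Let tM y A : t y A <= M. Proof. exact: (tv_le (TM y)). Qed.
Let tID y A D : t y A = t y (A `&` D) + t y (A `\` D).
Proof. exact: (tvID (TM y)). Qed.
Let tsub y A D : star A `<=` star D -> t y A <= t y D.
Proof. exact: (tv_mono (TM y)). Qed.

(** The variation is a supremum of the continuous functions [T f]. *)
Lemma tv_lsc A c y : c < t y A -> \forall z \near y, c < t z A.
Proof.
rewrite -subr_gt0 => c0.
have [_ [f Af <-]] := sup_adherent c0 (has_sup_tv (TM y) A).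
rewrite /tv subKr => cf.
have : \forall z \near y, c < T f z.
  exact: (@Cspace_continuous _ _ (T f) y) (open_nbhs_nbhs (conj (@open_gt R c) cf)).
by apply: filterS => z /lt_le_trans; apply; exact: (tv_ub (TM z)).
Qed.

Lemma tv_locally_constant_mass B : star B !=set0 -> exists A k,
  [/\ star A !=set0, star A `<=` star B & forall y, star A y -> t y setT = k].
Proof.
apply: (@lsc_star_constant _ _ _ M) => [c y _|y _]; first exact: tv_lsc.
by rewrite ger0_norm.
Qed.

Section constant_mass.
Variables (B : set nat) (k : R).
Hypothesis tk : forall y, star B y -> t y setT = k.

(** The variations of [A] and of its complement are lower semicontinuous with a
    constant sum. *)
Lemma tv_continuous A y : star B y -> t z A @[z --> y] --> t y A.
Proof.
move=> By.
have tC z : star B z -> t z A = k - t z (~` A).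
  by move=> Bz; rewrite -(tk Bz) (tID z setT A) setTI setTD addrK.
have FF : Filter (nbhs (y : Nstar)) := nbhs_filter y.
apply/cvgrPdist_lt => e e0.
have h1 := @tv_lsc A (t y A - e) y (ltac:(lra)).
have h2 := @tv_lsc (~` A) (t y (~` A) - e) y (ltac:(lra)).
apply: filterS (filterI (filterI h1 h2) (star_nbhs By)) => z [[h3 h4] Bz].
by have := tC y By; have := tC z Bz; rewrite ltr_distlC; lra.
Qed.

(** The members of a cover may overlap: only the effect of splitting one of
    them matters. *)
Definition star_cover s := forall x : Nstar, exists2 P, P \in s & star P x.

(** The infimum over all covers is the sum of the squares of the masses of the
    atoms of the measure. *)
Definition energy y s : R := \sum_(P <- s) t y P ^+ 2.

Lemma energy_ge0 y s : 0 <= energy y s.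
Proof. by apply: sumr_ge0 => P _; exact: sqr_ge0. Qed.

Lemma energy_continuous s y : star B y -> energy z s @[z --> y] --> energy y s.
Proof.
move=> By; have FF : Filter (nbhs (y : Nstar)) := nbhs_filter y.
rewrite /energy; elim: s => [|P s IH].
  by rewrite big_nil; under eq_fun do rewrite big_nil; exact: cvg_cst.
rewrite big_cons; under eq_fun do rewrite big_cons.
apply: cvgD => //; rewrite expr2; under eq_fun do rewrite expr2.
by apply: cvgM; exact: tv_continuous.
Qed.

(** The infimum of the energies is an upper semicontinuous function of [y]. *)
Lemma energy_locally_constant : star B !=set0 -> exists A e,
  [/\ star A !=set0, star A `<=` star B,
      forall y s, star A y -> star_cover s -> e <= energy y s &
      forall y d, star A y -> 0 < d ->
        exists2 s, star_cover s & energy y s < e + d].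
Proof.
move=> nB.
pose S y := [set - energy y s | s in star_cover].
(* The trivial cover bounds the infimum from above. *)
have cT : star_cover [:: setT].
  by move=> x; exists setT; [exact: mem_head|rewrite starT].
have hS y : has_sup (S y).
  split; first by exists (- energy y [:: setT]), [:: setT].
  by exists 0 => _ [s _ <-]; rewrite oppr_le0 energy_ge0.
have SP y s : star_cover s -> - energy y s <= sup (S y).
  by move=> cs; apply: ub_le_sup; [exact: (hS y).2|exists s].
have S0 y : sup (S y) <= 0.
  by apply: ge_sup; [exact: (hS y).1|move=> _ [s _ <-]; rewrite oppr_le0 energy_ge0].
have [||A [c [nA AB Ac]]] := @lsc_star_constant _ (fun y => sup (S y)) B (M ^+ 2) _ _ nB.
- move=> c y By cS; have d0 : 0 < sup (S y) - c by rewrite subr_gt0.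
  have [_ [s cs <-]] := sup_adherent d0 (hS y); rewrite subKr => cE.
  have FF : Filter (nbhs (y : Nstar)) := nbhs_filter y.
  have := @energy_continuous s y By.
  move=> /cvgr_lt /(_ (- c)); rewrite ltrNr => /(_ cE).
  by apply: filterS => z; rewrite ltrNr => /lt_le_trans; apply; exact: SP.
- move=> y _; rewrite ler0_norm// lerNl; apply: le_trans (SP y _ cT).
  rewrite lerN2 /energy big_cons big_nil addr0.
  apply: lerXn2r; rewrite ?nnegrE; [exact: t0| |exact: tM].
  exact: le_trans (t0 y setT) (tM y setT).
exists A, (- c); split=> // [y s Ay cs|y d Ay d0].
  by rewrite lerNl -(Ac _ Ay); exact: SP.
have [_ [s cs <-]] := sup_adherent d0 (hS y); rewrite Ac// => h.
by exists s => //; lra.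
Qed.

Lemma energy_split y (s1 s2 : seq (set nat)) P D :
  energy y (s1 ++ P :: s2) = energy y (s1 ++ (P `&` D) :: (P `\` D) :: s2) +
    2 * t y (P `&` D) * t y (P `\` D).
Proof. by rewrite /energy !big_cat !big_cons/= (tID y P D); ring. Qed.

(** The choice of a nearly optimal cover depends on [y], but by continuity one
    choice works on a neighbourhood; a generic clopen set lies in such a
    neighbourhood for every precision. *)
Lemma energy_minimal_coverings : star B !=set0 ->
  exists A e (s : nat -> seq (set nat)), [/\ star A !=set0, star A `<=` star B,
    forall n, star_cover (s n),
    forall y s, star A y -> star_cover s -> e <= energy y s &
    forall n y, star A y -> energy y (s n) < e + n.+1%:R^-1].
Proof.
move=> nB; have [A [e [nA AB eE Ee]]] := energy_locally_constant nB.
pose D n (W : set Nstar) :=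
  exists2 s, star_cover s & forall y, W y -> energy y s < e + n.+1%:R^-1.
have [||E [nE EA DE]] := @generic_star D A _ _ nA.
- move=> n E [y Ey] EA; have d0 : 0 < n.+1%:R^-1 :> R by rewrite invr_gt0.
  have [s cs Es] := Ee y _ (EA _ Ey) d0.
  have FF : Filter (nbhs (y : Nstar)) := nbhs_filter y.
  have := @energy_continuous s y (AB _ (EA _ Ey)) => /cvgr_lt /(_ _ Es).
  move=> /nbhs_Nstar[F Fy FE]; exists (E `&` F); split.
  + by exists y; rewrite starI.
  + by rewrite starI; exact: subIsetl.
  + by exists s => // z; rewrite starI => -[_ /FE].
- by move=> n E F EF [s cs h]; exists s => // y /EF; exact: h.
have /choice[s sP] : forall n, exists s, star_cover s /\
    forall y, star E y -> energy y s < e + n.+1%:R^-1.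
  by move=> n; have [s cs h] := DE n; exists s.
exists E, e, s; split=> //.
- exact: subset_trans AB.
- by move=> n; exact: (sP n).1.
- by move=> y s' /EA; exact: eE.
- by move=> n y Ey; exact: (sP n).2.
Qed.

End constant_mass.

(** The variation restricted to [star A] is a point mass or zero, stated
    without naming the point. *)
Definition two_valued y A := forall D, t y (A `&` D) = 0 \/ t y (A `\` D) = 0.

Definition subordinate (s : nat -> seq (set nat)) A :=
  forall n, exists2 P, P \in s n & star A `<=` star P.

(** Splitting the piece of the [n]th cover containing [A] into [A `&` D] and
    the rest lowers the energy by twice the product of the masses, and that
    cannot exceed [1/n]. *)
Lemma subordinate_two_valued (s : nat -> seq (set nat)) e y A :
  (forall n, star_cover (s n)) ->
  (forall s', star_cover s' -> e <= energy y s') ->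
  (forall n, energy y (s n) < e + n.+1%:R^-1) ->
  subordinate s A -> two_valued y A.
Proof.
move=> cs emin es sA D; apply: contrapT => /not_orP[a0 b0].
set a := t y (A `&` D) in a0; set b := t y (A `\` D) in b0.
have ab0 : 0 < a * b.
  by rewrite mulr_gt0// lt_def t0 andbT; apply/eqP.
(* A precision finer than the product of the two masses. *)
have [n _ /(_ n (leqnn n)) nab] := near_infty_natSinv_lt (PosNum ab0).
have {sA}[P Ps AP] := sA n.
have := cs n; have := es n; case/splitPr: Ps => s1 s2 en csn.
have cs' : star_cover (s1 ++ (P `&` (A `&` D)) :: (P `\` (A `&` D)) :: s2).
  move=> x; have [Q] := csn x; rewrite mem_cat inE => /or3P[Q1|/eqP ->|Q2] Qx.
  - by exists Q => //; rewrite mem_cat Q1.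
  - have [ADx|nAD] := pselect (star (A `&` D) x).
      by exists (P `&` (A `&` D)); [rewrite mem_cat !inE eqxx orbT|rewrite starI].
    by exists (P `\` (A `&` D)); [rewrite mem_cat !inE eqxx !orbT|rewrite starD].
  - by exists Q => //; rewrite mem_cat !inE Q2 !orbT.
have ha : a <= t y (P `&` (A `&` D)).
  by apply: tsub; rewrite !starI => x [Ax Dx]; split=> //; exact: AP.
have hb : b <= t y (P `\` (A `&` D)).
  by apply: tsub; rewrite !starD starI => x [Ax nD]; split; [exact: AP|case].
have huv := ler_pM (t0 y _) (t0 y _) ha hb.
have contra (w ab uv E' : R) : 0 < ab -> w < ab -> ab <= uv ->
  E' + 2 * uv < e + w -> e <= E' -> False by lra.
apply: (contra _ _ _ _ ab0 nab huv _ (emin _ cs')).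
by rewrite mulrA -energy_split.
Qed.

(** A generic clopen set is contained in a piece of every cover. *)
Lemma star_coverings_dense (s : nat -> seq (set nat)) :
  (forall n, star_cover (s n)) ->
  exists G : set Nstar, [/\ open G, dense G &
    forall x, G x -> exists2 A, star A x & subordinate s A].
Proof.
move=> cs; exists (\bigcup_(A in subordinate s) star A); split.
- by apply: bigcup_open => A _; exact: open_star.
- move=> U nU oU; have [A0 nA0 A0U] := open_star_sub oU nU.
  pose D n (W : set Nstar) := exists2 P, P \in s n & W `<=` star P.
  have [||A [[x Ax] AA0 AD]] := @generic_star D A0 _ _ nA0.
  + move=> n A [x Ax] _; have [P Ps Px] := cs n x.
    exists (A `&` P); rewrite starI; split; [by exists x|exact: subIsetl|].
    by exists P => //; exact: subIsetr.
  + by move=> n A B AB [P Ps BP]; exists P => //; exact: subset_trans BP.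
  + by exists x; split; [exact/A0U/AA0|exists A].
- by move=> x [A sA Ax]; exists A.
Qed.

Lemma locally_two_valued B : star B !=set0 ->
  exists B1 (G : set Nstar), [/\ star B1 !=set0, star B1 `<=` star B, open G, dense G &
    forall x, G x -> exists2 A, star A x & forall y, star B1 y -> two_valued y A].
Proof.
move=> nB; have [B1 [k [nB1 B1B tk]]] := tv_locally_constant_mass nB.
have [B2 [e [s [nB2 B2B1 cs emin es]]]] := energy_minimal_coverings tk nB1.
have [G [oG dG Gs]] := star_coverings_dense cs.
exists B2, G; split=> //; first exact: subset_trans B1B.
move=> x /Gs[A Ax sA]; exists A => // y B2y.
apply: (subordinate_two_valued cs _ _ sA); last by move=> n; exact: es.
by move=> s'; exact: emin.
Qed.

Lemma two_valued_sub y A D : two_valued y A -> star D `<=` star A -> two_valued y D.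
Proof.
move=> tA DA E; have [h|h] := tA E; [left|right]; apply/eqP; rewrite eq_le t0 andbT -h.
  by apply: tsub; rewrite !starI; exact: setSI.
by apply: tsub; rewrite !starD; exact: setSD.
Qed.

End variation_of_operator.

(** * Following the atom *)

Section canonization.
Variable R : realType.
Local Notation C := (Cspace R Nstar).
Variable T : {linear C -> C}.
Variable M : R.
Hypothesis TM : forall y, functional_bound M (fun f => T f y).

Local Notation t y := (tv (fun f => T f y)).
Implicit Types (A B D : set nat) (y z : Nstar) (f : C).

Let t0 y A : 0 <= t y A. Proof. exact: (tv_ge0 (TM y)). Qed.
Let tM y A : t y A <= M. Proof. exact: (tv_le (TM y)). Qed.
Let tID y A D : t y A = t y (A `&` D) + t y (A `\` D).
Proof. exact: (tvID (TM y)). Qed.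
Let tsub y A D : star A `<=` star D -> t y A <= t y D.
Proof. exact: (tv_mono (TM y)). Qed.

Definition atomic_on B A := forall y, star B y -> 0 < t y A /\ two_valued T y A.

(** [psi y] is the ultrafilter of the sets that meet [A] in positive variation:
    the location of the point mass. *)
Definition atom_map B A (psi : Nstar -> Nstar) := forall y, star B y ->
  star A (psi y) /\ forall D, star D (psi y) <-> 0 < t y (A `&` D).

Lemma atomic_on_atom_map B A : atomic_on B A -> exists psi, atom_map B A psi.
Proof.
move=> BA.
suff /choice[psi psiP] : forall y, exists x, star B y ->
    star A x /\ forall D, star D x <-> 0 < t y (A `&` D) by exists psi.
move=> y; have [By|nBy] := pselect (star B y); last by exists y.
have [tA tv2] := BA _ By; have [x Ax xP] := tv_support (TM y) tA.
exists x => _; split=> // D; split; first exact: xP.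
move=> AD; apply: contrapT => nDx; have := xP (~` D); rewrite starC => /(_ nDx).
rewrite -setDE; have [h|->] := tv2 D; last by rewrite ltxx.
by rewrite h ltxx in AD.
Qed.

Section atom_map.
Variables (B A : set nat) (psi : Nstar -> Nstar).
Hypotheses (BA : atomic_on B A) (psiP : atom_map B A psi).

(** Being positive is an open condition on the variation. *)
Lemma atom_map_nbhs D y : star B y -> star D (psi y) ->
  \forall z \near y, star B z /\ star D (psi z).
Proof.
move=> By /(psiP By).2 tD.
apply: filterS (filterI (star_nbhs By) (tv_lsc TM tD)) => z [Bz tz].
by split=> //; exact/(psiP Bz).2.
Qed.

Lemma atom_map_continuous y : star B y -> {for y, continuous psi}.
Proof.
move=> By W /nbhs_Nstar[D Dy DW].
by apply: filterS (atom_map_nbhs By Dy) => z [_ /DW].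
Qed.

Lemma atom_map_image_closed D : star D `<=` star B -> closed (psi @` star D).
Proof.
move=> DB; apply: compact_closed; first exact: Nstar_hausdorff.
apply: continuous_compact.
  by apply: continuous_in_subspaceT => y /[1!inE] /DB; exact: atom_map_continuous.
by apply: (subclosed_compact (@closed_star D) (@compact_setT Nstar)).
Qed.

Lemma atom_map_formula y (f : C) : star B y -> (forall z, ~ star A z -> f z = 0) ->
  T f y = f (psi y) * T (cindic R A) y.
Proof.
move=> By fA; have [Apsi psiD] := psiP By.
apply: (functional_dirac (TM y) Apsi) => // D Dpsi.
by have [h|//] := (BA By).2 D; move/psiD: Dpsi; rewrite h ltxx.
Qed.

(** For a point mass the mass and the variation agree up to sign. *)
Lemma atom_map_neq0 y : star B y -> T (cindic R A) y != 0.
Proof.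
move=> By; apply/eqP => TA; have := (BA By).1; rewrite ltNge => /negP; apply.
apply: (tv_lub (TM y)) => f [_ fA].
by rewrite (atom_map_formula By fA) TA mulr0.
Qed.

(** The complement of the preimage of [star E] in [star D] is the preimage of
    [star] of the complement of [E], so that both are open. *)
Lemma atom_map_preimage_clopen D E : star D `<=` star B ->
  exists F, star F = star D `&` psi @^-1` star E.
Proof.
move=> DB; set K := star D `&` psi @^-1` star E.
have cK : closed K.
  have -> : K = star D `&` ~` (star D `&` psi @^-1` star (~` E)).
    apply/seteqP; split=> y [Dy Ey]; split=> //; first by move=> [_]; rewrite /= starC.
    by apply: contrapT => nE; apply: Ey; split; rewrite //= starC.
  apply: closedI; first exact: closed_star.
  apply: open_closedC; rewrite openE => y [Dy Ey].
  by apply: filterS (filterI (star_nbhs Dy) (atom_map_nbhs (DB _ Dy) Ey)) => z [? []].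
have oK : open K.
  rewrite openE => y [Dy Ey].
  by apply: filterS (filterI (star_nbhs Dy) (atom_map_nbhs (DB _ Dy) Ey)) => z [? []].
have [F [KF FK]] := star_separation cK oK (@subset_refl _ K).
by exists F; apply/seteqP.
Qed.

End atom_map.

(** * Removing the atomless part *)

Section fusion.
Hypothesis Tf : fountainless T.

Definition variation_sup B (G : set Nstar) : R :=
  sup [set r | exists y A, [/\ star B y, star A `<=` G & r = t y A]].

Lemma has_sup_variation B G : star B !=set0 ->
  has_sup [set r | exists y A, [/\ star B y, star A `<=` G & r = t y A]].
Proof.
move=> [y By]; split; first by exists (t y set0), y, set0; split=> //; rewrite star0.
by exists M => _ [z [A [_ _ ->]]].
Qed.

(** The pairs of a nonempty clopen set and a dense open set are sigma-closed,
    because countable intersections of dense open sets have dense interior. *)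
Lemma variation_stable B0 (G0 : set Nstar) : star B0 !=set0 -> open G0 -> dense G0 ->
  exists B G, [/\ star B !=set0, star B `<=` star B0, open G /\ dense G, G `<=` G0 &
    forall B' G', star B' !=set0 -> star B' `<=` star B -> open G' -> dense G' ->
      G' `<=` G -> variation_sup B' G' = variation_sup B G].
Proof.
move=> nB0 oG0 dG0.
pose V := [set x : set nat * set Nstar |
  [/\ star x.1 !=set0, open x.2 & dense x.2]].
pose le (x y : set nat * set Nstar) := star x.1 `<=` star y.1 /\ x.2 `<=` y.2.
suff [[B G] [[nB oG dG] [BB0 GG0] BGP]] : exists x, [/\ V x, le x (B0, G0) &
    forall u, V u -> le u x -> variation_sup u.1 u.2 = variation_sup x.1 x.2].
  exists B, G; split=> // B' G' nB' B'B oG' dG' G'G.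
  exact: (BGP (B', G')).
apply: (@sigma_closed_stable _ le V _ _ _ R (fun x => variation_sup x.1 x.2) 0).
- by move=> x; split.
- by move=> y x z [xy1 xy2] [yz1 yz2]; split=> w; [move=> /xy1/yz1|move=> /xy2/yz2].
- move=> u Vu udec.
  have [B nB Bu] := star_sigma_closed (fun n => let: And3 h _ _ := Vu n in h)
    (fun n => (udec n).1).
  exists (B, (\bigcap_n (u n).2)°).
    split=> //; first exact: open_interior.
    by apply: star_dense_bigcap => n; have [] := Vu n.
  by move=> n; split=> //= x /interior_subset; exact.
- move=> [B G] [/= nB _ _]; have [y By] := nB.
  have h := has_sup_variation G nB; apply: le_trans (t0 y set0) _.
  by apply: ub_le_sup; [exact: h.2|exists y, set0; split=> //; rewrite star0].
- move=> [B G] [B' G'] [/= nB _ _] [/= nB' _ _] [/= BB' GG'].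
  apply: ge_sup; first exact: (has_sup_variation G nB).1.
  move=> _ [y [A [By AG ->]]]; apply: ub_le_sup; first exact: (has_sup_variation G' nB').2.
  by exists y, A; split=> //; [exact: BB'|exact: subset_trans GG'].
- by [].
Qed.

(** Choose a stable pair for [variation_sup], and a two-valued [A] charged at
    some point of it, with variation above [d] on a neighbourhood. An image
    [psi @` star D] with empty interior could be removed from [G]: each [C]
    inside the smaller set is disjoint from the point mass on [A], so that the
    variations of [C] and of [A] add up, and the supremum would drop by [d]. *)
Lemma exists_quasi_open_atom B0 : star B0 !=set0 ->
  (forall y, star B0 y -> exists f, T f y != 0) ->
  exists B A psi r, [/\ star B !=set0, star B `<=` star B0,
    atomic_on B A, atom_map B A psi &
    (forall y, star B y -> T (cindic R A) y = r) /\
    (forall D, star D !=set0 -> star D `<=` star B -> (psi @` star D)° !=set0)].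
Proof.
move=> nB0 nz.
have [B1 [G0 [nB1 B10 oG0 dG0 tvG0]]] := locally_two_valued TM nB0.
have [B2 [G [nB2 B21 [oG dG] GG0 stable]]] := variation_stable nB1 oG0 dG0.
have [y0 [A0 [By0 A0G tA0]]] : exists y A, [/\ star B2 y, star A `<=` G & 0 < t y A].
  apply: (fountainless_tv TM Tf oG dG (@open_star B2) nB2) => y /B21/B10; exact: nz.
have [x A0x xP] := tv_support (TM y0) tA0.
have [H Hx Htv] := tvG0 _ (GG0 _ (A0G _ A0x)).
pose A := A0 `&` H.
have tA : 0 < t y0 A by exact: xP.
have AG : star A `<=` G by move=> z; rewrite starI => -[/A0G].
have Atv y : star B1 y -> two_valued T y A.
  move=> By; apply: (two_valued_sub TM (Htv _ By)); rewrite starI; exact: subIsetr.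
(* Half of the mass survives on a whole neighbourhood of [y0]. *)
pose d := t y0 A / 2; have d0 : 0 < d by rewrite divr_gt0.
have dt : d < t y0 A by rewrite /d; lra.
have [E Ey0 Et] := nbhs_Nstar (tv_lsc TM dt).
(* The function [T 1_A] is continuous, so it is constant on part of [B3]. *)
pose B3 := B2 `&` E.
have nB3 : star B3 !=set0 by exists y0; rewrite starI.
have [||B4 [r [nB4 B43 Tr]]] :=
    @lsc_star_constant R (fun y => T (cindic R A) y) B3 M _ _ nB3.
- move=> c y _ cT.
  exact: (@Cspace_continuous _ _ (T (cindic R A)) y) (open_nbhs_nbhs (conj (@open_gt R c) cT)).
- by move=> y _; apply: le_trans (tv_cindic (TM y) A) (tM y A).
have B42 : star B4 `<=` star B2 by move=> y /B43; rewrite starI => -[].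
have td y : star B4 y -> d < t y A by move=> /B43; rewrite starI => -[_ /Et].
have BA : atomic_on B4 A.
  by move=> y By; split; [exact: lt_trans d0 (td _ By)|exact/Atv/B21/B42].
have [psi psiP] := atomic_on_atom_map BA.
exists B4, A, psi, r; split=> //.
  by move=> y /B42/B21/B10.
split=> // D nD DB; apply: contrapT => /set0P/negP; rewrite negbK => /eqP psiD0.
pose G' := G `\` psi @` star D.
have cpsi := atom_map_image_closed psiP DB.
have oG' : open G' by rewrite /G' setDE; apply: openI => //; exact: closed_openC.
have dG' : dense G'.
  move=> U nU oU; apply: contrapT => UG'.
  have [z [Uz Gz]] := dG U nU oU.
  suff : (psi @` star D)° z by rewrite psiD0.
  apply: (@filterS _ (nbhs z) _ (U `&` G)).
    move=> w [Uw Gw]; apply: contrapT => nw; apply: UG'; exists w; split=> //.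
  by apply: open_nbhs_nbhs; split=> //; exact: openI.
have hD := has_sup_variation G' nD; have hB := has_sup_variation G nB2.
have : variation_sup D G' <= variation_sup B2 G - d.
  apply: ge_sup; first exact: hD.1.
  move=> _ [y [F [Dy FG' ->]]].
  have By := DB _ Dy.
  have FA0 : t y (A `&` F) = 0.
    apply/eqP; rewrite eq_le t0 andbT leNgt; apply/negP => /(psiP _ By).2 /FG'[_].
    by apply; exists y.
  rewrite lerBrDr; apply: (@le_trans _ _ (t y (A `|` F))).
    rewrite (tID y (A `|` F) A) setUK addrC lerD//; first exact/ltW/td.
    rewrite (tID y F A) [F `&` A]setIC FA0 add0r; apply: tsub; apply: star_sub => n [Fn nA].
    by split=> //; right.
  apply: ub_le_sup; first exact: hB.2.
  exists y, (A `|` F); split=> //; first exact: B42.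
  by rewrite starU => z [/AG//|/FG'[]].
rewrite (stable D G' nD)//; first by lra.
- exact: subset_trans B42.
- by move=> z [].
Qed.

End fusion.

End canonization.

(** * Canonization *)

Lemma nbhs_Astar A (x : Astar A) (W : set (Astar A)) : nbhs x W ->
  exists D, star D (set_val x) /\ set_val @^-1` star D `<=` W.
Proof.
move=> [W' [[V oV <-] Vx VW]].
have [D Dx DV] := nbhs_Nstar (open_nbhs_nbhs (conj oV Vx)).
by exists D; split=> // y /DV; exact: VW.
Qed.

Lemma Astar_nbhs A (x : Astar A) D : star D (set_val x) ->
  nbhs x (set_val @^-1` star D : set (Astar A)).
Proof. by move=> Dx; apply: initial_continuous; exact: star_nbhs. Qed.

Section restriction.
Variables (A B : set nat) (psi : Nstar -> Nstar) (psi' : Astar B -> Astar A).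
Hypothesis psiE : forall x, set_val (psi' x) = psi (set_val x).

Lemma restriction_continuous : (forall y, star B y -> {for y, continuous psi}) ->
  continuous psi'.
Proof.
move=> cpsi x W /nbhs_Astar[D [Dx DW]].
rewrite psiE in Dx; have := cpsi _ (set_valP x) _ (star_nbhs Dx).
move=> /nbhs_Nstar[E Ex ED]; apply: filterS (Astar_nbhs Ex) => y Ey.
by apply: DW; rewrite /= psiE; exact: ED.
Qed.

Lemma restriction_surj : (forall z, star A z -> exists2 y, star B y & psi y = z) ->
  set_surj setT setT psi'.
Proof.
move=> h z _; have [y By yz] := h _ (set_valP z).
pose x : Astar B := SigSub (mem_set By).
have xz : set_val (psi' x) = set_val z by rewrite psiE; exact: yz.
by exists x => //; exact: val_inj xz.
Qed.

Lemma restriction_quasi_open : (forall y, star B y -> {for y, continuous psi}) ->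
  (forall D, star D !=set0 -> star D `<=` star B -> (psi @` star D)° !=set0) ->
  quasi_open psi'.
Proof.
move=> cpsi qpsi; split; first exact: restriction_continuous.
move=> U oU [x Ux]; have [D [Dx DU]] := nbhs_Astar (open_nbhs_nbhs (conj oU Ux)).
have [||z] := qpsi (D `&` B).
- by exists (set_val x); rewrite starI; split=> //; exact: (set_valP x).
- by rewrite starI; exact: subIsetr.
have lift w : star (D `&` B) w -> exists2 v, U v & set_val (psi' v) = psi w.
  rewrite starI => -[Dw Bw]; exists (SigSub (mem_set Bw)); last exact: psiE.
  exact: DU.
move=> /nbhs_Nstar[E Ez Epsi]; have [w Dw wz] := Epsi _ Ez.
have [v Uv vw] := lift _ Dw; exists (psi' v).
have Ev : star E (set_val (psi' v)) by rewrite vw wz.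
apply: filterS (Astar_nbhs Ev) => u /Epsi[w' /lift[v' Uv' v'w'] w'u].
have v'u : set_val (psi' v') = set_val u by rewrite v'w' w'u.
by exists v' => //; exact: val_inj v'u.
Qed.

End restriction.

Lemma everywhere_present_neq0 (R : realType)
    (T : {linear Cspace R Nstar -> Cspace R Nstar}) B :
  everywhere_present T -> infinite_set B ->
  exists y f, star B y /\ T f y != 0.
Proof.
move=> Te Binf; apply: contrapT => h; apply: (Te B Binf); apply/funext => f.
apply: CspaceP => x; apply/eqP/negPn/negP => Tfx; apply: h.
by exists (set_val x), f; split=> //; exact: (set_valP x).
Qed.

Theorem theorem5p6 (R : realType)
  (T : {linear Cspace R Nstar -> Cspace R Nstar}) :
  bounded_operator T -> fountainless T -> everywhere_present T ->
  left_locally_canonizable_quasi_open T.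
Proof.
move=> Tb Tf Te B Binf; have [M TM] := bounded_operator_functional Tb.
have [y0 [f0 [By0 Tfy0]]] := everywhere_present_neq0 Te Binf.
have oW : open [set y | star B y /\ T f0 y != 0].
  apply: openI; first exact: open_star.
  apply: (@open_comp _ _ (T f0) [set r : R | r != 0]) => [y _|].
    exact: Cspace_continuous.
  exact: open_neq.
have [B0 nB0 B0W] := open_star_sub oW (ex_intro _ y0 (conj By0 Tfy0)).
have [|D [A [psi [r [nD DB0 DA psiP [Tr psiq]]]]]] := exists_quasi_open_atom TM Tf nB0.
  by move=> y /B0W[_ h]; exists f0.
have [z0 z0psi] := psiq D nD (@subset_refl _ _).
have [A1 A1z0 A1psi] := nbhs_Nstar z0psi.
have [F FE] := atom_map_preimage_clopen TM psiP A1 (@subset_refl _ (star D)).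
(* The inclusion in [B] has to hold for sets of integers, not only up to finite
   sets. *)
have FB : star (F `&` B) = star F.
  rewrite starI setIidl// FE => y [/DB0/B0W[]].
  by [].
have BD : star (F `&` B) `<=` star D by rewrite FB FE; exact: subIsetl.
have BA1 y : star (F `&` B) y -> star A1 (psi y) by rewrite FB FE => -[].
have /choice[psi' psiE] : forall x : Astar (F `&` B), exists x' : Astar A1,
    set_val x' = psi (set_val x).
  by move=> x; exists (SigSub (mem_set (BA1 _ (set_valP x)))).
have A1A : star A1 `<=` star A by move=> z /A1psi[y Dy <-]; exact: (psiP _ Dy).1.
have cpsi y : star (F `&` B) y -> {for y, continuous psi}.
  by move=> /BD; exact: (atom_map_continuous TM psiP).
have preim z : star A1 z -> exists2 y, star (F `&` B) y & psi y = z.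
  move=> A1z; have [y Dy yz] := A1psi _ A1z; exists y => //.
  by rewrite FB FE; split=> //=; rewrite yz.
exists (F `&` B), A1, psi'; split.
- exact: subIsetr.
- by apply/star_neq0; have [y ? _] := preim _ A1z0; exists y.
- by apply/star_neq0; exists z0.
- apply: (restriction_quasi_open psiE) => // E nE EFB; apply: psiq => //.
  exact: subset_trans BD.
- split; [exact: (restriction_continuous psiE cpsi)|exact: (restriction_surj psiE preim)|].
  exists r.
    have [y Dy] := nD; rewrite -(Tr _ Dy); exact: (atom_map_neq0 TM DA psiP).
  move=> f x; have Dx := BD _ (set_valP x).
  transitivity (T (Iext A1 f) (set_val x)) => //.
  rewrite (atom_map_formula TM DA psiP Dx); last first.
    by move=> z nA; apply: valL_out; exact: (contra_not (@A1A z) nA).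
  by rewrite (Tr _ Dx) mulrC -psiE; congr (_ * _); exact: valL_in.
Qed.
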